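(* Let $\tau$ be a computable vocabulary, let $\mathcal{A}$ be a computable $\tau$-structure, and let $\phi$ be a Scott sentence for $\mathcal{A}$. If $\phi$ has a model of cardinality $\beth_\alpha$ for every ordinal $\alpha < \omega_1^{CK}$, then $\phi$ has models of all infinite cardinalities.
   Context: A vocabulary $\tau$ is computable if its set of symbols is computable and there is a computable function giving the arities of the symbols. A $\tau$-structure $\mathcal{A}$ whose universe is a subset of $\omega$ is computable if its atomic diagram $D(\mathcal{A})$ is computable (the elements of $\mathcal{A}$ are used as constants and sentences are identified with their Gödel numbers, so that $D(\mathcal{A})\subseteq\omega$). A Scott sentence for a countable structure $\mathcal{A}$ in a countable vocabulary $\tau$ is a sentence of $\mathcal{L}_{\omega_1,\omega}(\tau)$ whose countable models are exactly the isomorphic copies of $\mathcal{A}$. $\omega_1^{CK}$ is the first non-computable ordinal. The beth numbers are $\beth_0=\aleph_0$, $\beth_{\alpha+1}=2^{\beth_\alpha}$, and $\beth_\lambda=\sup_{\alpha<\lambda}\beth_\alpha$ for limit $\lambda$. *)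

(* Defs.v *)
From mathcomp Require Import all_boot.
From mathcomp Require Import boolp classical_sets functions cardinality.

Set Implicit Arguments.
Unset Strict Implicit.
Unset Printing Implicit Defensive.

Local Open Scope classical_set_scope.
Local Open Scope card_scope.

(* The total mu-recursive functions of n arguments: minimization is applied
   only when it yields a total function. *)
Inductive recursive : forall n, (n.-tuple nat -> nat) -> Prop :=
| rec_zero n : recursive (fun _ : n.-tuple nat => 0)
| rec_succ : recursive (fun v : 1.-tuple nat => (thead v).+1)
| rec_proj n (i : 'I_n) : recursive (fun v : n.-tuple nat => tnth v i)
| rec_comp n m (f : m.-tuple nat -> nat) (g : 'I_m -> n.-tuple nat -> nat) :
    recursive f -> (forall i, recursive (g i)) ->
    recursive (fun v => f [tuple g i v | i < m])
| rec_prec n (f : n.-tuple nat -> nat) (g : n.+2.-tuple nat -> nat)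
    (h : n.+1.-tuple nat -> nat) :
    recursive f -> recursive g ->
    (forall v : n.-tuple nat, h [tuple of 0 :: v] = f v) ->
    (forall x (v : n.-tuple nat),
       h [tuple of x.+1 :: v] = g [tuple of x :: h [tuple of x :: v] :: v]) ->
    recursive h
| rec_mu n (f : n.+1.-tuple nat -> nat) (h : n.-tuple nat -> nat) :
    recursive f ->
    (forall v : n.-tuple nat, f [tuple of h v :: v] = 0) ->
    (forall (v : n.-tuple nat) k, k < h v -> f [tuple of k :: v] <> 0) ->
    recursive h.

Definition computable_fun (f : nat -> nat) : Prop :=
  recursive (fun v : 1.-tuple nat => f (thead v)).

Definition computable_set (S : set nat) : Prop :=
  recursive (fun v : 1.-tuple nat => nat_of_bool `[< S (thead v) >]).

Definition computable_rel (R : nat -> nat -> Prop) : Prop :=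
  recursive (fun v : 2.-tuple nat =>
    nat_of_bool `[< R (tnth v ord0) (tnth v ord_max) >]).

(* Constants are function symbols of arity 0. *)
Record vocabulary : Type := Vocabulary {
  fsym : set nat;
  rsym : set nat;
  farity : fsym -> nat;
  rarity : rsym -> nat
}.

Definition computable_vocabulary (tau : vocabulary) : Prop :=
  [/\ computable_set (fsym tau),
      computable_set (rsym tau),
      (exists2 g, computable_fun g &
         forall f : fsym tau, g (set_val f) = farity f) &
      (exists2 g, computable_fun g &
         forall r : rsym tau, g (set_val r) = rarity r)].

Record structure (tau : vocabulary) (M : Type) : Type := Structure {
  universe_nonempty : inhabited M;
  fint : forall f : fsym tau, ('I_(farity f) -> M) -> M;
  rint : forall r : rsym tau, ('I_(rarity r) -> M) -> Prop
}.

Definition isomorphic (tau : vocabulary) (M N : Type)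
    (A : structure tau M) (B : structure tau N) : Prop :=
  exists h : M -> N,
    [/\ bijective h,
        (forall (f : fsym tau) v, h (fint A (f := f) v) = fint B (h \o v)) &
        (forall (r : rsym tau) v, rint A (r := r) v <-> rint B (h \o v))].

(* The leaves of a term come from V: variables when V is 'I_n, and names of
   elements when V is the universe of a structure. *)
Inductive term (tau : vocabulary) (V : Type) : Type :=
| Var (x : V)
| App (f : fsym tau) (ts : 'I_(farity f) -> term tau V).

Inductive atom (tau : vocabulary) (V : Type) : Type :=
| AEq (t u : term tau V)
| ARel (r : rsym tau) (ts : 'I_(rarity r) -> term tau V).

Fixpoint eval (tau : vocabulary) (M V : Type) (A : structure tau M)
    (e : V -> M) (t : term tau V) : M :=
  match t with
  | Var x => e x
  | App f ts => fint A (fun i => eval A e (ts i))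
  end.

Definition atom_holds (tau : vocabulary) (M V : Type) (A : structure tau M)
    (e : V -> M) (a : atom tau V) : Prop :=
  match a with
  | AEq t u => eval A e t = eval A e u
  | ARel r ts => rint A (fun i => eval A e (ts i))
  end.

(* Cantor's pairing function. *)
Definition npair (x y : nat) : nat := ((x + y) * (x + y).+1)./2 + y.

Definition nseq_code (s : seq nat) : nat :=
  foldr (fun x k => (npair x k).+1) 0 s.

Fixpoint term_code (tau : vocabulary) (U : set nat) (t : term tau U) : nat :=
  match t with
  | Var a => npair 0 (set_val a)
  | App f ts =>
      npair 1 (npair (set_val f)
        (nseq_code [seq term_code (ts i) | i <- enum 'I_(farity f)]))
  end.

Definition atom_code (tau : vocabulary) (U : set nat) (a : atom tau U) : nat :=
  match a with
  | AEq t u => npair 0 (npair (term_code t) (term_code u))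
  | ARel r ts =>
      npair 1 (npair (set_val r)
        (nseq_code [seq term_code (ts i) | i <- enum 'I_(rarity r)]))
  end.

(* Goedel numbers of the atomic sentences (tag 1) and negated atomic sentences
   (tag 0), with the elements of U as constants, that are true in A. *)
Definition atomic_diagram (tau : vocabulary) (U : set nat)
    (A : structure tau U) : set nat :=
  [set k | exists a : atom tau U,
     (atom_holds A id a /\ k = npair 1 (atom_code a)) \/
     (~ atom_holds A id a /\ k = npair 0 (atom_code a))].

Definition computable_structure (tau : vocabulary) (U : set nat)
    (A : structure tau U) : Prop :=
  computable_set (atomic_diagram A).

(* Formulas with free variables among 'I_n, in de Bruijn style: a quantifier
   binds ord0. Finite conjunctions and disjunctions are obtained by repeating
   members of the family. *)
Inductive formula (tau : vocabulary) : nat -> Type :=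
| FAtom n (a : atom tau 'I_n) : formula tau n
| FNot n (p : formula tau n) : formula tau n
| FConj n (p : nat -> formula tau n) : formula tau n
| FDisj n (p : nat -> formula tau n) : formula tau n
| FAll n (p : formula tau n.+1) : formula tau n
| FEx n (p : formula tau n.+1) : formula tau n.

Definition sentence (tau : vocabulary) : Type := formula tau 0.

Definition env_cons (M : Type) n (x : M) (e : 'I_n -> M) : 'I_n.+1 -> M :=
  fun i => oapp e x (unlift ord0 i).

Fixpoint sat (tau : vocabulary) (M : Type) (A : structure tau M) n
    (p : formula tau n) : ('I_n -> M) -> Prop :=
  match p in formula _ n return ('I_n -> M) -> Prop with
  | FAtom _ a => fun e => atom_holds A e a
  | FNot _ p => fun e => ~ sat A p e
  | FConj _ p => fun e => forall k, sat A (p k) e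
  | FDisj _ p => fun e => exists k, sat A (p k) e
  | FAll _ p => fun e => forall x, sat A p (env_cons x e)
  | FEx _ p => fun e => exists x, sat A p (env_cons x e)
  end.

Definition models (tau : vocabulary) (M : Type) (A : structure tau M)
    (p : sentence tau) : Prop :=
  forall e : 'I_0 -> M, sat A p e.

Definition scott_sentence (tau : vocabulary) (M : Type) (A : structure tau M)
    (p : sentence tau) : Prop :=
  forall (N : Type) (B : structure tau N), countable [set: N] ->
    (models B p <-> isomorphic B A).

(* An ordinal is presented by a well-ordered type. *)
Record well_order : Type := WellOrder {
  wcarrier :> Type;
  wlt : wcarrier -> wcarrier -> Prop;
  wlt_wf : well_founded wlt;
  wlt_trans : forall x y z, wlt x y -> wlt y z -> wlt x z;
  wlt_total : forall x y, wlt x y \/ x = y \/ wlt y x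
}.

(* [a] is isomorphic to an initial segment of [b]. *)
Definition ole (a b : well_order) : Prop :=
  exists f : a -> b,
    (forall x y, wlt x y -> wlt (f x) (f y)) /\
    (forall x z, wlt z (f x) -> exists y, f y = z).

Definition computable_ordinal (a : well_order) : Prop :=
  exists (D : set nat) (R : nat -> nat -> Prop),
    [/\ computable_set D, computable_rel R &
        exists f : a -> nat, set_bij [set: a] D f /\
          forall x y, wlt x y <-> R (f x) (f y)].

(* [a] is smaller than the first non-computable ordinal, that is, no ordinal
   up to and including [a] is non-computable. *)
Definition lt_omega1CK (a : well_order) : Prop :=
  forall b : well_order, ole b a -> computable_ordinal b.

Section BethHierarchy.
Variables (W : Type) (lt : W -> W -> Prop).

Definition is_zero (w : W) : Prop := forall v, ~ lt v w.

Definition is_succ (v w : W) : Prop :=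
  lt v w /\ forall u, ~ (lt v u /\ lt u w).

Definition is_limit (w : W) : Prop :=
  ~ is_zero w /\ forall v, ~ is_succ v w.

(* For a well-order [lt], this determines the cardinality of every [B w]; at a
   limit, [B w] is a least upper bound of the earlier cardinals. *)
Definition beth_hierarchy (B : W -> Type) : Prop :=
  [/\ (forall w, is_zero w -> [set: B w] #= [set: nat]),
      (forall v w, is_succ v w -> [set: B w] #= [set: set (B v)]) &
      (forall w, is_limit w ->
         (forall v, lt v w -> [set: B v] #<= [set: B w]) /\
         (forall C : Type, (forall v, lt v w -> [set: B v] #<= [set: C]) ->
            [set: B w] #<= [set: C]))].

End BethHierarchy.

(* The order of a + 1: [None] is placed above all of [a]. *)
Definition lt_top (a : well_order) (x y : option a) : Prop :=
  match x, y with
  | Some x, Some y => wlt x y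
  | Some _, None => True
  | None, _ => False
  end.

Definition has_card_beth (M : Type) (a : well_order) : Prop :=
  exists B : option a -> Type,
    beth_hierarchy (@lt_top a) B /\ [set: M] #= [set: B None].

(* Main.v *)
Require Import Defs.
From mathcomp Require Import all_boot.
From mathcomp Require Import boolp classical_sets functions cardinality.
From mathcomp Require wochoice.
From mathcomp Require Import zify.

(** A Scott sentence is complete for back-and-forth equivalence, so a model of
    [phi] of a given cardinality can be sought as a direct limit of copies of
    [A] whose transition maps do not change the type of any finite tuple.

    Such limits come from a [blueprint].  It assigns to every increasing map
    between finite ordinals, coded by the mask of its image, a self-embedding
    of [A] which coincides on each finite set with some automorphism; the
    assignment respects composition, and a point [d] of the copy attached to
    the ordinal 1 has different images under the two maps to the ordinal 2.
    Given a linear order on a set [X], one attaches a copy of [A] to each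
    finite subset of [X] and glues along the blueprint.  The resulting
    structure [stretch] is back-and-forth equivalent to [A], because tuples
    only move inside their automorphism orbits, hence it satisfies [phi]
    ([stretch_models]).  The images of [d] are indexed injectively by [X] and
    finite sequences over an infinite [X] are no more numerous than [X], so the
    cardinality is that of [X] ([stretch_card]).

    It remains to find a blueprint.  Together with witnessing automorphisms, it
    is coded by a function from nat to nat subject to [constraints], each of
    which involves four values and is decidable from the atomic diagram of [A].
    The finite sequences that violate no constraint form a computable tree, and
    its infinite branches are blueprints ([exists_blueprint]).  If there were no
    branch, the Kleene-Brouwer order of the tree would be a computable
    well-order, and so would its multiple by omega; by hypothesis [phi] would
    have a model [M] of the corresponding beth cardinality.

    This is contradictory, in the manner of Morley's omitting types argument.
    In [M] one chooses a countable hull for each finite subset, isomorphic to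
    [A] and increasing with the subset, so that the inclusions between hulls
    are pointwise limits of automorphisms of [A] ([good_hulls],
    [good_copies_conjugate]); this uses completeness of [phi], obtained here
    from a pressing-down argument for clubs of subsets of [M].  The
    coordinates of a would-be blueprint then become colourings of the
    increasing tuples of [M], and every infinite set on which finitely many
    coordinates are constant satisfies the constraints between their values
    ([model_realizes]).  Starting from [M] itself, the theorem of Erdos and
    Rado makes one coordinate after the other constant on subsets that stay
    large relative to the current node ([tree_descent]), which descends
    forever in a well-order.

    The tree only speaks of automorphisms of [A], never of [phi]: this is why
    computable ordinals suffice even though [phi] itself may be more
    complicated than any computable infinitary sentence. *)

Set Implicit Arguments.
Unset Strict Implicit.
Unset Printing Implicit Defensive.

Local Open Scope classical_set_scope.
Local Open Scope card_scope.

(** * Pairing and list codes *)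

(** One step along the antidiagonals, the order in which Cantor's pairing
    enumerates the pairs. *)
Definition unpair_next (p : nat * nat) : nat * nat :=
  if p.1 is x.+1 then (x, p.2.+1) else (p.2.+1, 0).

Definition unpair (k : nat) : nat * nat := iter k unpair_next (0, 0).

Definition fstn (k : nat) : nat := (unpair k).1.
Definition sndn (k : nat) : nat := (unpair k).2.

Fixpoint triangle (n : nat) : nat := if n is m.+1 then triangle m + n else 0.

Lemma npairE x y : npair x y = triangle (x + y) + y.
Proof.
rewrite /npair; congr addn; elim: (x + y) => //= n IHn.
by lia.
Qed.

Lemma npairK k : npair (fstn k) (sndn k) = k.
Proof.
rewrite /fstn /sndn; elim: k => //= k; rewrite !npairE.
case: (unpair k) => [[|x] y] /= <-; first by rewrite /= !addn0 addnS.
by rewrite !addnS /=; lia.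
Qed.

Lemma leq_triangle m n : m <= n -> triangle m <= triangle n.
Proof. by move/subnK <-; elim: (n - m) => //= k; lia. Qed.

Lemma npair_inj x y x' y' : npair x y = npair x' y' -> x = x' /\ y = y'.
Proof.
rewrite !npairE => e; have [lt|gt|eq] := ltngtP (x + y) (x' + y').
- by have /= := leq_triangle lt; lia.
- by have /= := leq_triangle gt; lia.
- by rewrite eq in e; lia.
Qed.

Lemma fstn_pair x y : fstn (npair x y) = x.
Proof. by have [] := npair_inj (npairK (npair x y)). Qed.

Lemma sndn_pair x y : sndn (npair x y) = y.
Proof. by have [] := npair_inj (npairK (npair x y)). Qed.

Lemma leq_npairr x y : y <= npair x y.
Proof. by rewrite npairE leq_addl. Qed.

Lemma nseq_code_inj : injective nseq_code.
Proof.
by elim=> [|x s IHs] [|y t] //= [] /npair_inj [-> /IHs ->].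
Qed.

Lemma nseq_code_surj k : exists s, nseq_code s = k.
Proof.
have [n] := ubnP k; elim: n k => // n IHn [|k] lekn; first by exists [::].
have [|s es] := IHn (sndn k); last by exists (fstn k :: s); rewrite /= es npairK.
by have := leq_npairr (fstn k) (sndn k); rewrite npairK; lia.
Qed.

Definition nseq_decode (k : nat) : seq nat := projT1 (cid (nseq_code_surj k)).

Lemma nseq_decodeK : cancel nseq_decode nseq_code.
Proof. by move=> k; rewrite /nseq_decode; case: cid. Qed.

Lemma nseq_codeK : cancel nseq_code nseq_decode.
Proof. by move=> s; apply: nseq_code_inj; rewrite nseq_decodeK. Qed.

Lemma size_nseq_code s : size s <= nseq_code s.
Proof.
by elim: s => //= x s IHs; have := leq_npairr x (nseq_code s); lia.
Qed.

(** * Recursive functions of lists of arguments *)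

(** Functions are taken on all lists so that arguments can be consed and
    projected without casts; only the lists of length [n] matter. *)
Definition rec n (F : seq nat -> nat) : Prop :=
  recursive (fun v : n.-tuple nat => F v).

Definition recb n (P : seq nat -> bool) : Prop := rec n (fun s => P s).

Lemma eq_rec n F G :
  (forall s, size s = n -> F s = G s) -> rec n F -> rec n G.
Proof.
move=> FG; rewrite /rec; set f := fun _ => _; set g := fun _ => _.
suff -> : g = f by [].
by apply/funext => v; rewrite /f /g FG // size_tuple.
Qed.

Lemma rec_comp_seq n m F (G : nat -> seq nat -> nat) :
  rec m F -> (forall i, i < m -> rec n (G i)) ->
  rec n (fun s => F (mkseq (G^~ s) m)).
Proof.
move=> rF rG.
have := rec_comp rF (fun i : 'I_m => rG i (ltn_ord i)).
set f := fun _ => _; set g := fun _ => _; suff -> : f = g by [].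
apply/funext => v; rewrite /f /g; congr F.
apply: (@eq_from_nth _ 0); rewrite size_tuple ?size_mkseq // => i ltim.
rewrite (nth_mkseq _ _ ltim) -[i]/(val (Ordinal ltim)).
by rewrite -tnth_nth tnth_mktuple.
Qed.

Lemma rec_const n c : rec n (fun _ => c).
Proof.
elim: c => [|c IHc]; first exact: rec_zero.
have r1 : rec 1 (fun s => (nth 0 s 0).+1).
  have := rec_succ; rewrite /rec; set f := fun _ => _; set g := fun _ => _.
  suff -> : f = g by []. by apply/funext => v; rewrite /f /g /thead (tnth_nth 0).
exact: (@rec_comp_seq n 1 _ (fun _ _ => c) r1).
Qed.

Lemma rec_nth n i : rec n (fun s => nth 0 s i).
Proof.
case: (ltnP i n) => [lt|le]; last first.
  apply: eq_rec (rec_const n 0) => s ss; rewrite nth_default //; lia.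
have := rec_proj (Ordinal lt); rewrite /rec; set f := fun _ => _; set g := fun _ => _.
suff -> : f = g by []. by apply/funext => v; rewrite /f /g (tnth_nth 0).
Qed.

Definition rec1 (f : nat -> nat) := rec 1 (fun s => f (nth 0 s 0)).
Definition rec2 (f : nat -> nat -> nat) :=
  rec 2 (fun s => f (nth 0 s 0) (nth 0 s 1)).

Lemma rec_app1 f n G : rec1 f -> rec n G -> rec n (fun s => f (G s)).
Proof. by move=> rf rG; apply: (@rec_comp_seq n 1 _ (fun _ => G) rf). Qed.

Lemma rec_app2 f n G H :
  rec2 f -> rec n G -> rec n H -> rec n (fun s => f (G s) (H s)).
Proof.
move=> rf rG rH.
by apply: (@rec_comp_seq n 2 _ (fun i => if i is 0 then G else H) rf) => -[].
Qed.

Lemma rec_S n G : rec n G -> rec n (fun s => (G s).+1).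
Proof.
apply: (@rec_app1 S); have := rec_succ; rewrite /rec1 /rec.
set f := fun _ => _; set g := fun _ => _; suff -> : f = g by [].
by apply/funext => v; rewrite /f /g /thead (tnth_nth 0).
Qed.

Lemma rec_prec_seq n F G (H : seq nat -> nat) : rec n F -> rec n.+2 G ->
  (forall s, H (0 :: s) = F s) ->
  (forall x s, H (x.+1 :: s) = G [:: x, H (x :: s) & s]) ->
  rec n.+1 H.
Proof.
move=> rF rG H0 HS; apply: (rec_prec rF rG) => [v|x v] /=.
  exact: H0.
exact: HS.
Qed.

(** Primitive recursion in the form in which it is used below: the bound may
    depend on the arguments. *)
Lemma rec_iteri n F G k : rec n F -> rec n.+2 G -> rec n k ->
  rec n (fun s => iteri (k s) (fun x r => G [:: x, r & s]) (F s)).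
Proof.
move=> rF rG rk.
pose H s := iteri (head 0 s) (fun x r => G [:: x, r & behead s]) (F (behead s)).
have rH : rec n.+1 H by apply: rec_prec_seq rF rG _ _.
have rg i : i < n.+1 -> rec n (fun s => if i is j.+1 then nth 0 s j else k s).
  by case: i => // i _; apply: rec_nth.
apply: eq_rec (rec_comp_seq rH rg) => s ss.
suff -> : mkseq (fun i => if i is j.+1 then nth 0 s j else k s) n.+1 = k s :: s by [].
apply: (@eq_from_nth _ 0); rewrite size_mkseq /= ?ss // => i lt.
by rewrite nth_mkseq //; case: i lt.
Qed.

Lemma rec_add n F G : rec n F -> rec n G -> rec n (fun s => F s + G s).
Proof.
move=> rF rG; apply: eq_rec (rec_iteri (G := fun s => (nth 0 s 1).+1) rF _ rG).
  by move=> s _; elim: (G s) => [|k /= ->]; rewrite ?addn0 ?addnS.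
exact/rec_S/rec_nth.
Qed.

Lemma rec_pred n F : rec n F -> rec n (fun s => (F s).-1).
Proof.
move=> rF; apply: eq_rec (rec_iteri (G := fun s => nth 0 s 0) (rec_const n 0) _ rF).
  by move=> s _; case: (F s).
exact: rec_nth.
Qed.

Lemma rec_sub n F G : rec n F -> rec n G -> rec n (fun s => F s - G s).
Proof.
move=> rF rG; apply: eq_rec (rec_iteri (G := fun s => (nth 0 s 1).-1) rF _ rG).
  by move=> s _; elim: (G s) => [|k /= ->]; rewrite ?subn0 ?subnS.
exact/rec_pred/rec_nth.
Qed.

Lemma rec_if n P F G :
  recb n P -> rec n F -> rec n G -> rec n (fun s => if P s then F s else G s).
Proof.
move=> rP rF rG.
have r3 : rec 3 (fun s => iteri (nth 0 s 0) (fun _ _ => nth 0 s 1) (nth 0 s 2)).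
  by apply: (@rec_iteri 3 (fun s => nth 0 s 2) (fun s => nth 0 s 3) (fun s => nth 0 s 0));
    apply: rec_nth.
pose g i : seq nat -> nat := match i with 0 => (fun s => P s : nat) | 1 => F | _ => G end.
have rg i : i < 3 -> rec n (g i) by move: i => [|[|[]]].
by apply: eq_rec (rec_comp_seq r3 rg) => s _ /=; case: (P s).
Qed.

Lemma recb_not n P : recb n P -> recb n (fun s => ~~ P s).
Proof.
move=> rP; apply: eq_rec (rec_if rP (rec_const n 0) (rec_const n 1)) => s _.
by case: (P s).
Qed.

Lemma recb_and n P Q : recb n P -> recb n Q -> recb n (fun s => P s && Q s).
Proof.
move=> rP rQ; apply: eq_rec (rec_if rP rQ (rec_const n 0)) => s _.
by case: (P s).
Qed.

Lemma recb_or n P Q : recb n P -> recb n Q -> recb n (fun s => P s || Q s).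
Proof.
move=> rP rQ; apply: eq_rec (rec_if rP (rec_const n 1) rQ) => s _.
by case: (P s).
Qed.

Lemma recb_imp n P Q : recb n P -> recb n Q -> recb n (fun s => P s ==> Q s).
Proof.
move=> rP rQ; apply: eq_rec (rec_if rP rQ (rec_const n 1)) => s _.
by case: (P s).
Qed.

Lemma recb_pos n F : rec n F -> recb n (fun s => 0 < F s).
Proof.
move=> rF; apply: eq_rec (rec_iteri (G := fun=> 1) (rec_const n 0) _ rF).
  by move=> s _; case: (F s).
exact: rec_const.
Qed.

Lemma recb_lt n F G : rec n F -> rec n G -> recb n (fun s => F s < G s).
Proof.
move=> rF rG; apply: eq_rec (recb_pos (rec_sub rG rF)) => s _.
by rewrite subn_gt0.
Qed.

Lemma recb_eq n F G : rec n F -> rec n G -> recb n (fun s => F s == G s).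
Proof.
move=> rF rG.
apply: eq_rec (recb_and (recb_not (recb_lt rF rG)) (recb_not (recb_lt rG rF))).
by move=> s _; rewrite -!leqNgt andbC -eqn_leq.
Qed.

Lemma recb_all n P F : recb n.+1 P -> rec n F ->
  recb n (fun s => all (fun x => P (x :: s)) (iota 0 (F s))).
Proof.
move=> rP rF.
have rG : recb n.+2 (fun s => (0 < nth 0 s 1) && P (nth 0 s 0 :: behead (behead s))).
  apply: recb_and; first exact/recb_pos/rec_nth.
  pose g i s := nth 0 s (if i is j.+1 then j.+2 else 0).
  have rg i : i < n.+1 -> rec n.+2 (g i) by move=> _; apply: rec_nth.
  apply: eq_rec (rec_comp_seq rP rg) => -[|x [|y s]] //= [ss].
  congr (nat_of_bool (P _)).
  apply: (@eq_from_nth _ 0); rewrite size_mkseq /= ?ss // => i lt.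
  by rewrite nth_mkseq // /g; case: i lt.
apply: eq_rec (rec_iteri (rec_const n 1) rG rF) => s _.
elim: (F s) => // k IHk.
by rewrite -[in RHS]addn1 iotaD all_cat [LHS]/= IHk /= add0n andbT; case: all.
Qed.

Lemma recb_has n P F : recb n.+1 P -> rec n F ->
  recb n (fun s => has (fun x => P (x :: s)) (iota 0 (F s))).
Proof.
move=> rP rF; apply: eq_rec (recb_not (recb_all (recb_not rP) rF)) => s _.
by rewrite all_predC negbK.
Qed.

(** Minimization, for a function characterized as a least witness. *)
Lemma rec_least n P F : recb n.+1 P ->
  (forall s, size s = n -> P (F s :: s)) ->
  (forall s x, size s = n -> x < F s -> ~~ P (x :: s)) -> rec n F.
Proof.
move=> rP PF nP; apply: (rec_mu (recb_not rP)) => [v|v k] /=.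
  by rewrite PF // size_tuple.
by move=> /nP -> //; rewrite size_tuple.
Qed.

Lemma rec_pair n F G : rec n F -> rec n G -> rec n (fun s => npair (F s) (G s)).
Proof.
apply: rec_app2.
have rt : rec 2 (fun s => iteri (nth 0 s 0 + nth 0 s 1)
    (fun x r => nth 0 [:: x, r & s] 1 + (nth 0 [:: x, r & s] 0).+1) 0).
  apply: (rec_iteri (G := fun s => nth 0 s 1 + (nth 0 s 0).+1)).
  - exact: rec_const.
  - by apply: rec_add; [|apply: rec_S]; apply: rec_nth.
  - by apply: rec_add; apply: rec_nth.
apply: eq_rec (rec_add rt (rec_nth 2 1)) => s _ /=; rewrite npairE.
by congr addn; elim: (_ + _) => //= k ->.
Qed.

Lemma rec_fst n F : rec n F -> rec n (fun s => fstn (F s)).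
Proof.
apply: rec_app1.
apply: (@rec_least 1 (fun s =>
  has (fun y => npair (nth 0 (y :: s) 1) (nth 0 (y :: s) 0) == nth 0 (y :: s) 2)
      (iota 0 (nth 0 s 1).+1))).
- apply: (recb_has (P := fun s => npair (nth 0 s 1) (nth 0 s 0) == nth 0 s 2)).
    by apply: recb_eq; [apply: rec_pair|]; apply: rec_nth.
  exact/rec_S/rec_nth.
- move=> [|k []] // _; apply/hasP.
  exists (sndn k); last by rewrite /= npairK.
  by rewrite mem_iota /= add0n ltnS -{2}[k]npairK leq_npairr.
- move=> [|k []] // x _ lt; apply/hasP => -[y _ /= /eqP e].
  by rewrite /= -e fstn_pair ltnn in lt.
Qed.

Lemma rec_snd n F : rec n F -> rec n (fun s => sndn (F s)).
Proof.
apply: rec_app1.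
apply: (@rec_least 1 (fun s => npair (fstn (nth 0 s 1)) (nth 0 s 0) == nth 0 s 1)).
- by apply: recb_eq; [apply: rec_pair; [apply: rec_fst|]|]; apply: rec_nth.
- by move=> [|k []] //= _; rewrite npairK.
- move=> [|k []] //= x _ lt; apply/eqP => e.
  by rewrite -e sndn_pair ltnn in lt.
Qed.

Lemma computable_setP (S : set nat) : computable_set S <-> rec1 (fun k => `[< S k >]).
Proof.
rewrite /computable_set /rec1 /rec; set f := fun _ => _; set g := fun _ => _.
suff -> : f = g by []. by apply/funext => v; rewrite /f /g /thead (tnth_nth 0).
Qed.

Lemma computable_relP (R : nat -> nat -> Prop) :
  computable_rel R <-> rec2 (fun x y => `[< R x y >]).
Proof.
rewrite /computable_rel /rec2 /rec; set f := fun _ => _; set g := fun _ => _.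
suff -> : f = g by []. by apply/funext => v; rewrite /f /g !(tnth_nth 0).
Qed.

(** * Lists inside recursive functions *)

Definition code_behead (c : nat) : nat := sndn c.-1.
Definition code_drop (i c : nat) : nat := iter i code_behead c.
Definition code_has (c i : nat) : bool := 0 < code_drop i c.
Definition code_nth (c i : nat) : nat := fstn (code_drop i c).-1.

Lemma code_dropE i s : code_drop i (nseq_code s) = nseq_code (drop i s).
Proof.
have b t : code_behead (nseq_code t) = nseq_code (behead t).
  by case: t => [|x t]; rewrite /code_behead //= sndn_pair.
elim: i s => [|i IHi] s; rewrite ?drop0 // /code_drop iterSr b.
by rewrite -/(code_drop _ _) IHi; case: s.
Qed.

Lemma code_hasE s i : code_has (nseq_code s) i = (i < size s).
Proof.
rewrite /code_has code_dropE; have := size_drop i s.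
by case: (drop i s) => [|x t] /=; lia.
Qed.

Lemma code_nthE s i : code_nth (nseq_code s) i = nth 0 s i.
Proof.
rewrite /code_nth code_dropE -{2}[i]addn0 -nth_drop.
by case: (drop i s) => [|x t] //=; rewrite fstn_pair.
Qed.

Lemma rec_code_drop n F G :
  rec n F -> rec n G -> rec n (fun s => code_drop (F s) (G s)).
Proof.
move=> rF rG.
apply: eq_rec (rec_iteri (G := fun s => code_behead (nth 0 s 1)) rG _ rF).
  by move=> s _; elim: (F s) => //= k ->.
exact/rec_snd/rec_pred/rec_nth.
Qed.

Lemma recb_code_has n F G :
  rec n F -> rec n G -> recb n (fun s => code_has (F s) (G s)).
Proof. by move=> rF rG; apply/recb_pos/rec_code_drop. Qed.

Lemma rec_code_nth n F G :
  rec n F -> rec n G -> rec n (fun s => code_nth (F s) (G s)).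
Proof. by move=> rF rG; apply/rec_fst/rec_pred/rec_code_drop. Qed.

(** * The Kleene-Brouwer order *)

Fixpoint kb_lt (s t : seq nat) : bool :=
  match s, t with
  | [::], _ => false
  | _ :: _, [::] => true
  | x :: s, y :: t => (x < y) || (x == y) && kb_lt s t
  end.

Lemma kb_ltxx s : kb_lt s s = false.
Proof. by elim: s => //= x s ->; rewrite ltnn andbF. Qed.

Lemma kb_lt_trans s t r : kb_lt s t -> kb_lt t r -> kb_lt s r.
Proof.
elim: s t r => [|x s IHs] [|y t] [|z r] //= /orP[xy|/andP[/eqP<- st]] /orP[yz|/andP[/eqP<- tr]].
- by rewrite (ltn_trans xy yz).
- by rewrite xy.
- by rewrite yz.
- by rewrite eqxx (IHs _ _ st tr) orbT.
Qed.

Lemma kb_lt_total s t : [|| kb_lt s t, s == t | kb_lt t s].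
Proof.
elim: s t => [|x s IHs] [|y t] //=.
rewrite eqseq_cons; case: (ltngtP x y) => //= _; exact: IHs.
Qed.

Lemma kb_lt_rcons s x : kb_lt (rcons s x) s.
Proof. by elim: s => //= y s ->; rewrite eqxx orbT. Qed.

(** The recursion defining [kb_lt] runs over two lists at once; a bounded search
    for the first difference is what the closure properties of recursive
    functions can handle. *)
Lemma kb_lt_search s t N : size s <= N ->
  kb_lt s t = has (fun i => [&& all (fun j => (j < size t) && (nth 0 s j == nth 0 t j)) (iota 0 i),
     i < size s & (size t <= i) || (nth 0 s i < nth 0 t i)]) (iota 0 N).
Proof.
move=> leN; apply/idP/hasP => [|[i _ /and3P[/allP]]].
  suff: kb_lt s t -> exists2 i, i < size s & [/\ forall j, j < i ->
      (j < size t) && (nth 0 s j == nth 0 t j) & (size t <= i) || (nth 0 s i < nth 0 t i)].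
    move=> h /h [i lti [h1 h2]]; exists i; first by rewrite mem_iota; lia.
    by rewrite lti h2 !andbT; apply/allP => j; rewrite mem_iota => /h1.
  elim: s t {leN} => [|x s IHs] [|y t] //=; first by exists 0.
  case/orP => [xy|/andP[/eqP <- /IHs[i lti [h1 h2]]]]; first by exists 0; rewrite ?xy ?orbT.
  by exists i.+1 => //; split=> // -[|j] /=; rewrite ?eqxx // => /h1.
move=> h1 lti h2; have {}h1 j : j < i -> (j < size t) && (nth 0 s j == nth 0 t j).
  by move=> ltj; apply: h1; rewrite mem_iota.
elim: s t i {leN} lti h1 h2 => [|x s IHs] [|y t] // [|i] //= lti h1 h2; first by rewrite h2.
have /= -> := h1 0 isT; rewrite (IHs _ i) ?orbT // => j ltj; exact: (h1 j.+1).
Qed.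

Lemma rec2_kb_lt : rec2 (fun c d => kb_lt (nseq_decode c) (nseq_decode d)).
Proof.
pose P (s : seq nat) := [&& all (fun j => code_has (nth 0 (j :: s) 3) (nth 0 (j :: s) 0) &&
   (code_nth (nth 0 (j :: s) 2) (nth 0 (j :: s) 0) == code_nth (nth 0 (j :: s) 3) (nth 0 (j :: s) 0)))
     (iota 0 (nth 0 s 0)),
  code_has (nth 0 s 1) (nth 0 s 0) & ~~ code_has (nth 0 s 2) (nth 0 s 0) ||
   (code_nth (nth 0 s 1) (nth 0 s 0) < code_nth (nth 0 s 2) (nth 0 s 0))].
have rP : recb 3 P.
  apply: recb_and; last apply: recb_and; last apply: recb_or.
  - apply: (recb_all (P := fun s => code_has (nth 0 s 3) (nth 0 s 0) &&
      (code_nth (nth 0 s 2) (nth 0 s 0) == code_nth (nth 0 s 3) (nth 0 s 0)))); last exact: rec_nth.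
    by apply: recb_and; [apply: recb_code_has|apply: recb_eq; apply: rec_code_nth]; apply: rec_nth.
  - by apply: recb_code_has; apply: rec_nth.
  - by apply/recb_not/recb_code_has; apply: rec_nth.
  - by apply: recb_lt; apply: rec_code_nth; apply: rec_nth.
apply: eq_rec (recb_has rP (rec_nth 2 0)) => s _.
rewrite (@kb_lt_search _ _ (nth 0 s 0)) ?(leq_trans (size_nseq_code _)) ?nseq_decodeK //.
set c := nth 0 s 0; set d := nth 0 s 1; congr nat_of_bool; apply: eq_has => i.
rewrite /P /= -/c -/d -[c]nseq_decodeK -[d]nseq_decodeK !code_hasE !code_nthE !nseq_codeK -leqNgt.
by congr andb; apply: eq_all => j; rewrite code_hasE !code_nthE.
Qed.

Lemma kb_lt_cat r s t : kb_lt (r ++ s) (r ++ t) = kb_lt s t.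
Proof. by elim: r => //= x r ->; rewrite ltnn eqxx. Qed.

Section KleeneBrouwer.
Variable T : seq nat -> bool.
Hypothesis T_prefix : forall s x, T (rcons s x) -> T s.
Hypothesis T_computable : rec1 (fun c => T (nseq_decode c)).
Hypothesis T_wf : ~ exists g : nat -> nat, forall n, T (mkseq g n).

Let kb_above (s t u : seq nat) : Prop :=
  [/\ kb_lt t u, T t & exists r, t = s ++ r].

(** Well-foundedness of the part of the tree above [s].  Accessibility of [s]
    itself would not do for the induction: the nodes to the left of [s] are
    below it and need not be accessible when only the part above [s] is known. *)
Let kb_wf_above s := forall r, T (s ++ r) -> Acc (kb_above s) (s ++ r).

(** The part above [s] is the sum, in the order of [x], of the parts above the
    children [rcons s x], followed by [s] as last element. *)
Lemma kb_wf_above_step s : (forall x, kb_wf_above (rcons s x)) -> kb_wf_above s.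
Proof.
move=> wfs.
have child x r : T (s ++ x :: r) -> Acc (kb_above s) (s ++ x :: r).
  elim/ltn_ind: x r => x IHx r Tr.
  have := wfs x r; rewrite cat_rcons => /(_ Tr).
  move: {1 3}(s ++ x :: r) (erefl (s ++ x :: r)) => t et acct.
  elim: acct r et {Tr} => {}t _ IHt r et.
  constructor=> u [ut Tu [r' eu]]; case: r' => [|y r'] in eu.
    by move: ut; rewrite eu kb_lt_cat.
  move: (ut); rewrite eu kb_lt_cat /= => /orP[yx|/andP[/eqP yx _]].
    by apply: IHx; rewrite // -eu.
  rewrite {}yx in eu *; apply: (IHt u) => //.
  by split; rewrite ?et //; exists r'; rewrite cat_rcons.
move=> [|x r]; last exact: child.
rewrite cats0 => _; constructor=> u [us Tu [[|y r] eu]].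
  by move: us; rewrite eu cats0 kb_ltxx.
by rewrite eu; apply: child; rewrite -eu.
Qed.

(** If the order were ill-founded above the root, [kb_wf_above_step] would lead
    from each ill-founded node to an ill-founded child, producing a branch. *)
Lemma kb_wf s : T s -> Acc (fun t u => kb_lt t u /\ T t) s.
Proof.
suff wf0 : kb_wf_above [::].
  move=> /wf0 /=; elim=> {s} s _ IHs; constructor=> t [ts Tt].
  by apply: IHs; split=> //; exists t.
apply: contrapT => nwf0; apply: T_wf => {s}.
have next s : {x | ~ kb_wf_above s -> ~ kb_wf_above (rcons s x)}.
  apply: cid; case: (pselect (kb_wf_above s)) => [?|nwf]; first by exists 0.
  apply: contrapT => /forallNP h; apply: nwf; apply: kb_wf_above_step => x.
  by apply: contrapT => nx; apply: (h x).
pose st := fix st n : seq nat := if n is m.+1 then rcons (st m) (projT1 (next (st m))) else [::].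
have sz n : size (st n) = n by elim: n => //= n IHn; rewrite size_rcons IHn.
have nst n : ~ kb_wf_above (st n) by elim: n => //= n IHn; case: (next _) => x /=; apply.
exists (fun n => projT1 (next (st n))) => n.
have -> : mkseq (fun n => projT1 (next (st n))) n = st n.
  by elim: n => [|n IHn] //; rewrite mkseqS IHn.
have /existsNP[r /not_implyP[Tr _]] := nst n.
elim/last_ind: r Tr => [|r x IHr]; rewrite ?cats0 // -rcons_cat.
by move/T_prefix.
Qed.

Definition kb_node : Type := {s : seq nat | T s}.

(** The order of the tree times omega.  The copies of omega leave room, between
    a node and its children, for the finitely many power sets that one use of
    the Erdos-Rado theorem costs. *)
Definition kb_omega_lt (p q : kb_node * nat) : Prop :=
  kb_lt (val p.1) (val q.1) \/ p.1 = q.1 /\ p.2 < q.2.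

Lemma kb_omega_wf : well_founded kb_omega_lt.
Proof.
move=> [[s Ts] n].
have acc := kb_wf Ts; elim: acc Ts n => {}s _ IHs Ts n.
elim/ltn_ind: n => n IHn; constructor=> -[[t Tt] m] [/= ts|/= [e mn]].
  exact: IHs.
have {}e : t = s := congr1 val e; move: Tt; rewrite {}e => Tt.
by rewrite (bool_irrelevance Tt Ts); apply: IHn.
Qed.

Lemma kb_omega_trans p q r : kb_omega_lt p q -> kb_omega_lt q r -> kb_omega_lt p r.
Proof.
case=> [pq|[pq pq2]] [qr|[qr qr2]].
- by left; apply: kb_lt_trans pq qr.
- by left; rewrite -qr.
- by left; rewrite pq.
- by right; split; [rewrite pq|apply: ltn_trans qr2].
Qed.

Lemma kb_omega_total p q : kb_omega_lt p q \/ p = q \/ kb_omega_lt q p.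
Proof.
case: p q => [s n] [t m]; have /or3P[st|/eqP/val_inj ->|ts] := kb_lt_total (val s) (val t).
- by left; left.
- case: (ltngtP n m) => [lt|gt|->]; first by left; right.
    by right; right; right.
  by right; left.
- by right; right; left.
Qed.

Definition kb_omega : well_order :=
  WellOrder kb_omega_wf kb_omega_trans kb_omega_total.

Let code (p : kb_omega) : nat := npair (nseq_code (val p.1)) p.2.

Let code_inj p q : code p = code q -> p = q.
Proof.
case: p q => [s n] [t m] /npair_inj [/nseq_code_inj/val_inj /= -> /= ->] //.
Qed.

Let D (c : nat) : bool := T (nseq_decode (fstn c)).
Let R (c d : nat) : bool :=
  kb_lt (nseq_decode (fstn c)) (nseq_decode (fstn d)) ||
  (fstn c == fstn d) && (sndn c < sndn d).

Let recD : rec1 D.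
Proof. exact: (rec_app1 T_computable (rec_fst (rec_nth 1 0))). Qed.

Let recR n F G : rec n F -> rec n G -> recb n (fun s => R (F s) (G s)).
Proof.
move=> rF rG; apply: recb_or.
  apply: (rec_app2 (f := fun c d => kb_lt (nseq_decode c) (nseq_decode d))); try exact: rec_fst.
  exact: rec2_kb_lt.
by apply: recb_and; [apply: recb_eq; apply: rec_fst|apply: recb_lt; apply: rec_snd].
Qed.

Let codeR p q : R (code p) (code q) <-> wlt p q.
Proof.
rewrite /R /code !fstn_pair !sndn_pair !nseq_codeK (inj_eq nseq_code_inj).
split=> [/orP[|/andP[/eqP/val_inj]]|[->|[-> ->]]] //; first by left.
  by right.
by rewrite eqxx orbT.
Qed.

Let codeD p : D (code p).
Proof. by rewrite /D /code fstn_pair nseq_codeK; case: p => -[]. Qed.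

Let codeD_surj c : D c -> exists p, code p = c.
Proof.
move=> Dc; exists (exist (fun s => T s) _ Dc : kb_node, sndn c).
by rewrite /code /= nseq_decodeK npairK.
Qed.

(** A proper initial segment is the set of predecessors of its least upper
    bound, which is decidable because the order is. *)
Lemma kb_omega_lt_omega1CK : lt_omega1CK kb_omega.
Proof.
move=> b [f [f_mono f_init]].
have [D' [recD' D'D D'E]] : exists D' : nat -> bool, [/\ rec1 D',
    forall c, D' c -> exists p, code p = c &
    forall p, D' (code p) <-> exists y, f y = p].
  case: (pselect (exists p, ~ exists y, f y = p)) => [[p0 np0]|h]; last first.
    exists D; split=> [|c /codeD_surj //|p]; [exact: recD|split=> _; last exact: codeD].
    by apply: contrapT => np; apply: h; exists p.
  have [p [np pmin]] : exists p, (~ exists y, f y = p) /\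
      forall q, wlt q p -> exists y, f y = q.
    elim: (wlt_wf p0) np0 => {}p0 _ IH np0.
    case: (pselect (exists2 q, wlt q p0 & ~ exists y, f y = q)) => [[q qp nq]|h].
      exact: IH nq.
    by exists p0; split=> // q qp; apply: contrapT => nq; apply: h; exists q.
  (* [p] is the least element outside the segment. *)
  exists (fun c => D c && R c (code p)).
  split=> [|c /andP[/codeD_surj] //|q].
    by have := recb_and (recD : recb 1 (fun s => D (nth 0 s 0)))
      (recR (rec_nth 1 0) (rec_const 1 (code p))).
  rewrite codeD /= codeR; split=> [/pmin //|[y yq]].
  have [//|[qp|pq]] := wlt_total q p; first by case: np; exists y; rewrite yq qp.
  by case: np; apply: (f_init y); rewrite yq.
have irr (p : kb_omega) : ~ wlt p p by case=> [|[_]]; rewrite ?kb_ltxx ?ltnn.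
have finj : injective f.
  by move=> x y e; have [/f_mono|[//|/f_mono]] := wlt_total x y; rewrite e => /irr.
have f_reflect x y : wlt (f x) (f y) -> wlt x y.
  have [//|[->|/f_mono yx]] := wlt_total x y; first by move/irr.
  by move/(wlt_trans yx)/irr.
exists [set c | D' c], (fun c d => R c d); split.
- apply/computable_setP; apply: eq_rec recD' => s _; congr nat_of_bool.
  by apply/idP/asboolP.
- apply/computable_relP; apply: eq_rec (recR (rec_nth 2 0) (rec_nth 2 1)) => s _.
  by congr nat_of_bool; apply/idP/asboolP.
- exists (code \o f); split; last first.
    by move=> x y; split=> [/f_mono/codeR|/codeR/f_reflect].
  split=> [x _|x y _ _ /code_inj/finj //|c /= D'c] /=; first by apply/D'E; exists x.
  have [p pc] := D'D _ D'c; move: D'c; rewrite -pc => /D'E[y yp].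
  by exists y; rewrite //= yp.
Qed.

End KleeneBrouwer.

(** * Comparing cardinals by injections *)

Definition embeds (K T : Type) (Y : set T) : Prop :=
  exists f : K -> T, injective f /\ forall k, Y (f k).

Lemma card_le_embeds K T (Y : set T) : ([set: K] #<= Y) <-> embeds K Y.
Proof.
split=> [/card_leP/injfunPex[f _ finj]|[f [finj fY]]].
  exists (fun k => set_val (f (SigSub (mem_set (I : [set: K] k))))); split.
    by move=> x y /val_inj /(finj _ _ (mem_set I) (mem_set I)) [].
  by move=> k; apply: set_mem; apply: (valP (f _)).
have [g] : $|{injfun [set: K] >-> Y}|.
  by apply/injfunPex; exists f => [x _|x y _ _ /finj].
exact: inj_card_le.
Qed.

Lemma embeds_trans K L T (Y : set T) : embeds K [set: L] -> embeds L Y -> embeds K Y.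
Proof.
move=> [f [finj _]] [g [ginj gY]]; exists (g \o f); split=> [|k] /=; last exact: gY.
exact: inj_comp.
Qed.

Lemma embeds_inj K L (f : K -> L) : injective f -> embeds K [set: L].
Proof. by move=> finj; exists f. Qed.

Definition partial_inj (K T : Type) (Y : set T) (G : set (K * T)) : Prop :=
  [/\ forall k x, G (k, x) -> Y x,
      forall k x x', G (k, x) -> G (k, x') -> x = x' &
      forall k k' x, G (k, x) -> G (k', x) -> k = k'].

(** A maximal partial injection is total or onto [Y]. *)
Lemma embeds_total K T (Y : set T) :
  embeds K Y \/ exists g : T -> K, {in Y &, injective g}.
Proof.
have [|G [[GY Gfun Ginj] Gmax]] := @Zorn_bigcup (K * T)%type (partial_inj Y).
  move=> F FP Ftot; split.
  - by move=> k x [G FG Gkx]; have [GY _ _] := FP _ FG; apply: GY Gkx.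
  - move=> k x x' [G FG Gkx] [G' FG' Gkx'].
    have [_ Gf _] := FP _ FG; have [_ Gf' _] := FP _ FG'.
    by have [/(_ _ Gkx) h|/(_ _ Gkx') h] := Ftot _ _ FG FG'; [apply: Gf' h _|apply: Gf _ h].
  - move=> k x x' [G FG Gkx] [G' FG' Gkx'].
    have [_ _ Gf] := FP _ FG; have [_ _ Gf'] := FP _ FG'.
    by have [/(_ _ Gkx) h|/(_ _ Gkx') h] := Ftot _ _ FG FG'; [apply: Gf' h _|apply: Gf _ h].
case: (pselect (forall k, exists x, G (k, x))) => [/choice[f fG]|/existsNP[k0 /forallNP nk0]].
  left; exists f; split=> [k k' e|k]; last exact: GY (fG k).
  by apply: Ginj (fG k) _; rewrite e.
right; case: (pselect (forall x, exists k, Y x -> G (k, x))) => [/choice[g gG]|/existsNP[x0 /forallNP nx0]].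
  exists g => x y /set_mem Yx /set_mem Yy e.
  by apply: Gfun (gG x Yx) _; rewrite e; apply: gG.
exfalso; have Yx0 : Y x0 by have /not_implyP[] := nx0 k0.
have {}nx0 k : ~ G (k, x0) by have /not_implyP[] := nx0 k.
apply: (Gmax (G `|` [set (k0, x0)])).
  by split=> [p|/(_ (k0, x0) (or_intror erefl))]; [left|apply: nk0].
split.
- by move=> k x [/GY//|[_ ->]].
- move=> k x x' [Gkx|[ek ->]] [Gkx'|[ek' ->]] //; first exact: Gfun Gkx Gkx'.
    by case: (nk0 x); rewrite -ek'.
  by case: (nk0 x'); rewrite -ek.
- move=> k k' x [Gkx|[-> ek]] [Gkx'|[-> ek']] //; first exact: Ginj Gkx Gkx'.
    by case: (nx0 k); rewrite -ek'.
  by case: (nx0 k'); rewrite -ek.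
Qed.

(** Iterated power sets replace beth numbers: the partition theorem only needs
    finitely many of them above an arbitrary cardinal. *)
Fixpoint pow (m : nat) (K : Type) : Type :=
  if m is n.+1 then set (pow n K) else K.

Lemma image_set_inj T U (f : T -> U) :
  injective f -> injective (fun A : set T => f @` A).
Proof.
move=> finj A B e; apply/seteqP; split=> x Ax.
  by have : (f @` B) (f x) by [rewrite -e; exists x]; case=> y By /finj <-.
by have : (f @` A) (f x) by [rewrite e; exists x]; case=> y By /finj <-.
Qed.

Lemma Cantor T (f : set T -> T) : ~ injective f.
Proof.
move=> finj; pose D : set T := [set x | exists2 A, x = f A & ~ A x].
have [DD|nDD] := pselect (D (f D)); last by case: (nDD); exists D.
by have [A /finj <-] := DD.
Qed.

Lemma pair_set_inj K : injective (fun p : K * K => [set [set p.1]; [set p.1; p.2]]).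
Proof.
move=> [a b] [c d] /= e.
have eac : a = c.
  have : [set [set c]; [set c; d]] [set a] by rewrite -e; left.
  case=> h; first by have : [set c] a by [rewrite -h].
  by have : [set a] c by [rewrite h; left].
subst c; congr pair.
have : [set [set a]; [set a; d]] [set a; b] by rewrite -e; right.
have : [set [set a]; [set a; b]] [set a; d] by rewrite e; right.
case=> h1.
  have eda : d = a by have : [set a] d by [rewrite -h1; right].
  case=> h2; have : [set a; b] b by right.
    by rewrite h2 eda.
  by rewrite h2 => -[|] ->.
move=> _; have : [set a; d] d by right.
rewrite h1 => -[da|//]; have : [set a; b] b by right.
by rewrite -h1 => -[|] ->.
Qed.

(** Three power sets suffice without any cardinal arithmetic: a list is a set of
    pairs (position, entry), positions being coded in [K], and pairs are sets of
    sets. *)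
Lemma seq_pow_embeds K : embeds nat [set: K] -> embeds (seq K) [set: pow 3 K].
Proof.
move=> [u [uinj _]].
pose graph (s : seq K) : set (K * K) := [set p | exists2 i, p.1 = u i & onth s i = Some p.2].
have graph_inj : injective graph.
  move=> s t e.
  have h s' t' : graph s' = graph t' -> forall i x, onth s' i = Some x -> onth t' i = Some x.
    move=> {}e i x ex; have : graph t' (u i, x) by rewrite -e; exists i.
    by case=> j /= /uinj <-.
  suff: onth s =1 onth t.
    elim: s t {e} => [|x s IHs] [|y t] // e; try by have := e 0.
    by have [->] := e 0; rewrite (IHs t) // => i; have := e i.+1.
  move=> i; case es: (onth s i) => [x|]; first by rewrite (h _ _ e _ _ es).
  by case et: (onth t i) => [x|//]; rewrite (h _ _ (esym e) _ _ et) in es.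
apply: embeds_inj (inj_comp (image_set_inj (@pair_set_inj K)) graph_inj).
Qed.

(** * A partition theorem of Erdos and Rado *)

Section ErdosRado.
Variables (M : eqType) (lt : rel M).
Hypothesis lt_wf : well_founded lt.
Hypothesis lt_trans : transitive lt.
Hypothesis lt_total : forall x y, [\/ lt x y, x = y | lt y x].

Lemma lt_irr x : ~ lt x x.
Proof. by elim: (lt_wf x) => {}x _ IH xx; apply: (IH x). Qed.

Definition within (Y : set M) (s : seq M) : Prop := forall x, x \in s -> Y x.

Lemma within_rcons Y s x : within Y (rcons s x) <-> within Y s /\ Y x.
Proof.
split=> [h|[h Yx] y]; last by rewrite mem_rcons in_cons => /orP[/eqP->|/h].
by split=> [y ys|]; apply: h; rewrite mem_rcons in_cons ?ys ?orbT ?eqxx.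
Qed.

Lemma sorted_rcons s y : sorted lt (rcons s y) = all (lt^~ y) s && sorted lt s.
Proof. by rewrite !(sorted_pairwise lt_trans) pairwise_rcons. Qed.

(** The colour of an increasing list does not depend on its last entry. *)
Definition end_homogeneous n (f : seq M -> nat) (Y : set M) : Prop :=
  forall s y z, size s = n -> sorted lt (rcons s y) -> sorted lt (rcons s z) ->
    within Y (rcons s y) -> within Y (rcons s z) ->
    f (rcons s y) = f (rcons s z).

Section Ramification.
Variables (n : nat) (f : seq M -> nat) (X : set M).

(** Ramification: [ram x] is an end-homogeneous set of predecessors of [x], built
    greedily from below; [y] is admitted if it cannot be distinguished from [x]
    by the colours of lists whose other entries were admitted before. *)
Definition ram_body (x y : M) (ram : forall z, lt z y -> Prop) : Prop :=
  [/\ X y, lt y x &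
      forall s, size s = n -> sorted lt s ->
        (forall z, z \in s -> exists h : lt z y, ram z h) ->
        f (rcons s y) = f (rcons s x)].

Definition ram (x : M) : M -> Prop := Fix lt_wf (fun _ => Prop) (ram_body x).

Lemma ramE x y : ram x y <-> [/\ X y, lt y x &
   forall s, size s = n -> sorted lt s -> within [set z | lt z y /\ ram x z] s ->
     f (rcons s y) = f (rcons s x)].
Proof.
rewrite {1}/ram Fix_eq -/(ram x); last first.
  move=> {}y p q pq; congr ram_body.
  by apply: functional_extensionality_dep => z; apply: functional_extensionality_dep.
split=> -[Xy yx h]; split=> // s ss srt hs; apply: h => // z /hs.
  by case=> zy rz; exists zy.
by case=> zy rz; split.
Qed.

Lemma ram_end_homogeneous x : end_homogeneous n f (ram x).
Proof.
suff h s y : size s = n -> sorted lt (rcons s y) -> within (ram x) (rcons s y) ->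
    f (rcons s y) = f (rcons s x).
  by move=> s y z ss sy sz wy wz; rewrite (h s y) // (h s z).
move=> ss; rewrite sorted_rcons => /andP[/allP lty srt] /within_rcons[ws /ramE[_ _ h]].
by apply: h => // z zs; split; [apply: lty|apply: ws].
Qed.

Variables (K : Type) (u : nat -> K) (g : M -> M -> K).
Hypothesis u_inj : injective u.
Hypothesis g_inj : forall x, X x -> forall y z, ram x y -> ram x z -> g x y = g x z -> y = z.

(** Copies to [K], along [g x], the order of [ram x] and the colours of its
    increasing lists extended by [x].  The first entry tells the two kinds of
    records apart. *)
Definition ram_code (x : M) : set (seq K) := [set l |
  (exists y z, [/\ ram x y, ram x z, y = z \/ lt y z & l = [:: u 0; g x y; g x z]]) \/
  (exists s, [/\ within (ram x) s, sorted lt s, size s = n &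
     l = u (f (rcons s x)).+1 :: map (g x) s])].

Section CodeInjective.
Variables (x x' : M).
Hypotheses (Xx : X x) (Xx' : X x') (code_eq : ram_code x = ram_code x').

Let agree y := ram x y -> ram x' y /\ g x y = g x' y.

Lemma ram_code_pair y z : ram x y -> ram x z -> y = z \/ lt y z ->
  exists y' z', [/\ ram x' y', ram x' z', y' = z' \/ lt y' z', g x y = g x' y' &
    g x z = g x' z'].
Proof.
move=> ry rz yz; have : ram_code x [:: u 0; g x y; g x z] by left; exists y, z.
rewrite code_eq => -[[y' [z' [ry' rz' yz' [-> ->]]]]|[s [_ _ _ [/u_inj //]]]].
by exists y', z'.
Qed.

Lemma ram_code_color s : within (ram x) s -> sorted lt s -> size s = n ->
  (forall y, y \in s -> agree y) -> f (rcons s x) = f (rcons s x').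
Proof.
move=> ws srt ss ag.
have : ram_code x (u (f (rcons s x)).+1 :: map (g x) s) by right; exists s.
rewrite code_eq => -[[y' [z' [_ _ _ [/u_inj //]]]]|[s' [ws' _ ss' [/u_inj [->] e]]]].
congr (f (rcons _ _)); elim: s s' ws ws' ag e {srt ss ss'} => [|y s IHs] [|y' s'] //=.
move=> ws ws' ag [ey es].
have [ry' egy] : ram x' y /\ g x y = g x' y.
  by apply: ag; [rewrite mem_head|apply: ws; rewrite mem_head].
congr cons.
  apply/esym/(g_inj Xx') => //; last by rewrite -egy ey.
  by apply: ws'; rewrite mem_head.
apply: IHs => // z zs; [apply: ws|apply: ws'|apply: ag]; by rewrite in_cons zs orbT.
Qed.
End CodeInjective.

(** If [y] corresponds to [y'] then, the two sets being the same below, the smaller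
    of [y] and [y'] meets the criterion for admission to the other set; being
    below the element that corresponds to it there, it would be below itself. *)
Lemma ram_code_agree x x' y : X x -> X x' -> ram_code x = ram_code x' ->
  (forall z, lt z y -> ram x z -> ram x' z /\ g x z = g x' z) ->
  ram x y -> ram x' y /\ g x y = g x' y.
Proof.
move=> Xx Xx' e IH ry.
have [y' [_ [ry' _ _ gy _]]] := ram_code_pair e ry ry (or_introl erefl).
have inj' := g_inj Xx'; have inj := g_inj Xx.
have below z : lt z y -> ram x z -> lt z y'.
  move=> zy rz; have [z1 [y1 [rz1 ry1 zy1 gz1 gy1]]] := ram_code_pair e rz ry (or_intror zy).
  have [rz' gz'] := IH _ zy rz.
  have ey1 : y1 = y' by apply: inj'; rewrite // -gy1.
  have ez1 : z1 = z by apply: inj'; rewrite // -gz1.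
  case: zy1; rewrite ey1 ez1 // => ezy.
  by case: (@lt_irr y); rewrite -{1}(_ : z = y) //; apply: inj; rewrite // gy -ezy.
have below' z : lt z y' -> ram x' z -> lt z y /\ ram x z.
  move=> zy rz; have [z1 [y1 [rz1 ry1 zy1 gz1 gy1]]] := ram_code_pair (esym e) rz ry' (or_intror zy).
  have ey1 : y1 = y by apply: inj; rewrite // -gy1.
  case: zy1; rewrite ey1 => zy1.
    case: (@lt_irr y'); rewrite -{1}(_ : z = y') //; apply: inj' => //.
    by rewrite gz1 zy1.
  have [rz1' gz1'] := IH _ zy1 rz1.
  suff <- : z1 = z by []. by apply: inj'; rewrite // -gz1'.
have color s : size s = n -> sorted lt s -> within [set z | lt z y /\ ram x z] s ->
    f (rcons s x) = f (rcons s x').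
  move=> ss srt ws; apply: (ram_code_color Xx' e) => // z /ws[zy rz] //.
  by move=> _; apply: IH.
have [Xy yx h] := (ramE x y).1 ry; have [Xy' yx' h'] := (ramE x' y').1 ry'.
case: (lt_total y y') => [yy'|eyy'|y'y]; last 1 first.
- suff /(below _ y'y)/lt_irr : ram x y' by [].
  apply/ramE; split=> // [|s ss srt ws]; first exact: lt_trans y'y yx.
  have ws1 : within [set z | lt z y /\ ram x z] s.
    by move=> z /ws[zy rz]; split=> //; apply: lt_trans zy y'y.
  rewrite (h' s) // ?color // => z zs; have [zy rz] := ws1 _ zs; split.
    exact: below.
  by have [] := IH _ zy rz.
- suff /(below' _ yy')[/lt_irr] : ram x' y by [].
  apply/ramE; split=> // [|s ss srt ws]; first exact: lt_trans yy' yx'.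
  have ws1 : within [set z | lt z y /\ ram x z] s.
    move=> z /ws[zy rz]; split=> //.
    by have [] := below' _ (lt_trans zy yy') rz.
  by rewrite (h s) // color.
- by subst y'; split.
Qed.

(** Once [ram x] and [ram x'] are known to be equal, the smaller of [x] and [x']
    would itself be admitted to the ramification of the other. *)
Lemma ram_code_inj x x' : X x -> X x' -> ram_code x = ram_code x' -> x = x'.
Proof.
move=> Xx Xx' e.
have ag y : (ram x y -> ram x' y /\ g x y = g x' y) /\
            (ram x' y -> ram x y /\ g x' y = g x y).
  elim: (lt_wf y) => {}y _ IH.
  by split; apply: ram_code_agree => // z zy; have [] := IH z zy.
have ne x1 x2 : X x1 -> X x2 -> ram_code x1 = ram_code x2 ->
    (forall y, ram x1 y -> ram x2 y /\ g x1 y = g x2 y) ->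
    (forall y, ram x2 y -> ram x1 y) -> ~ lt x1 x2.
  move=> X1 X2 e12 ag1 ag2 lt12.
  suff /ag2/ramE[_ /lt_irr] : ram x2 x1 by [].
  apply/ramE; split=> // s ss srt ws.
  apply: (ram_code_color X2 e12) => // z; first by move=> /ws[_ /ag2].
  by move=> _; apply: ag1.
have [n12 n21] : ~ lt x x' /\ ~ lt x' x.
  by split; apply: ne => // y ry; have [h1 h2] := ag y; tauto.
by case: (lt_total x x').
Qed.

End Ramification.

(** If no [ram x] is as large as [K], all of them embed in [K], and their codes
    give an injection of [X] into the sets of lists over [K], which are too few. *)
Lemma end_homogeneous_subset n (f : seq M -> nat) (X : set M) (K : Type) :
  embeds nat [set: K] -> embeds (pow 5 K) X ->
  exists Y : set M, [/\ Y `<=` X, embeds K Y & end_homogeneous n f Y].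
Proof.
move=> infK [e [e_inj eX]]; have [u [u_inj _]] := infK.
case: (pselect (exists2 x, X x & embeds K (ram n f X x))) => [[x Xx Kx]|nex].
  exists (ram n f X x); split=> //; last exact: ram_end_homogeneous.
  by move=> y /ramE[].
exfalso; have [g gP] : exists g : M -> M -> K, forall x, X x ->
    forall y z, ram n f X x y -> ram n f X x z -> g x y = g x z -> y = z.
  suff /choice[g gP] : forall x, exists gx : M -> K, X x ->
      forall y z, ram n f X x y -> ram n f X x z -> gx y = gx z -> y = z by exists g.
  move=> x; case: (pselect (X x)) => [Xx|nXx]; last by exists (fun=> u 0).
  have [Kx|[gx gxP]] := embeds_total K (ram n f X x); first by case: nex; exists x.
  by exists gx => _ y z ry rz; apply: gxP; rewrite inE.
have [c [c_inj _]] := seq_pow_embeds infK.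
apply: (@Cantor (pow 4 K) (fun a => c @` ram_code n f X u g (e a))) => a b.
move=> /(image_set_inj c_inj) /(ram_code_inj u_inj gP (eX a) (eX b)).
exact: e_inj.
Qed.

(** Induction on the length: an end-homogeneous subset reduces lists of length
    [n.+1] to lists of length [n], at the cost of five power sets. *)
Theorem erdos_rado (n : nat) : exists m, forall (K : Type) (X : set M) (f : seq M -> nat),
  embeds nat [set: K] -> embeds (pow m K) X ->
  exists Y c, [/\ Y `<=` X, embeds K Y &
    forall s, size s = n -> sorted lt s -> within Y s -> f s = c].
Proof.
elim: n => [|n [m IHm]].
  by exists 0 => K X f _ KX; exists X, (f [::]); split=> // -[].
exists (5 + m) => K X f infK KX.
have infm : embeds nat [set: pow m K].
  apply: embeds_trans infK _; elim: m {IHm KX} => [|m [h [hinj _]]]; first exact: embeds_inj (@inj_id K).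
  exists (fun k => [set h k]); split=> // x y exy; apply: hinj.
  by have : [set h y] (h x) by rewrite -exy.
have [Z [ZX Km hZ]] := end_homogeneous_subset n f infm KX.
have [g gP] : exists g : seq M -> nat, forall s y, size s = n -> sorted lt (rcons s y) ->
    within Z (rcons s y) -> f (rcons s y) = g s.
  suff /choice[g gP] : forall s, exists c, forall y, size s = n -> sorted lt (rcons s y) ->
    within Z (rcons s y) -> f (rcons s y) = c by exists g.
  move=> s; case: (pselect (exists y, sorted lt (rcons s y) /\ within Z (rcons s y))).
    by move=> [y [sy wy]]; exists (f (rcons s y)) => z ss sz wz; apply: hZ.
  by move=> nex; exists 0 => y ss sy wy; case: nex; exists y.
have [Y [c [YZ KY hY]]] := IHm _ _ g infK Km.
exists Y, c; split=> // [x /YZ /ZX //|s].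
case/lastP: s => // s y; rewrite size_rcons => -[ss] srt ws.
rewrite gP // ?hY //; last by move=> z /ws /YZ.
  by move: srt; rewrite sorted_rcons => /andP[].
by case/within_rcons: ws.
Qed.

End ErdosRado.

(** * Well-orders and increasing lists *)

Lemma exists_well_order (M : eqType) : exists lt : rel M,
  [/\ well_founded lt, transitive lt & forall x y, [\/ lt x y, x = y | lt y x]].
Proof.
have [R woR] := wochoice.well_ordering_principle M.
have minR (s : seq M) : s != [::] -> exists2 z, z \in s & {in s, forall x, R z x}.
  case: s => // x s _; have [|z [[zs zmin] _]] := woR (mem (x :: s)).
    by exists x; apply: mem_head.
  by exists z.
have Rxx x : R x x.
  by have [//|z] := minR [:: x]; rewrite inE => /eqP -> ->; rewrite ?mem_head.
have tot x y : R x y || R y x.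
  have [//|z] := minR [:: x; y]; rewrite !inE => /orP[] /eqP -> h.
    by rewrite h // !inE eqxx orbT.
  by rewrite h ?orbT // !inE eqxx.
have anti x y : R x y -> R y x -> x = y.
  move=> xy yx; have [|z [_ zu]] := woR (mem [:: x; y]); first by exists x; apply: mem_head.
  have zx : z = x by apply: zu; split=> [|w]; rewrite !inE ?eqxx //= => /orP[]/eqP ->.
  by rewrite -zx; apply: zu; split=> [|w]; rewrite !inE ?eqxx ?orbT //= => /orP[]/eqP ->.
have trans x y z : R x y -> R y z -> R x z.
  move=> xy yz; have [//|w] := minR [:: x; y; z].
  rewrite !inE => /or3P[] /eqP -> h; first by rewrite h // !inE eqxx !orbT.
    by rewrite (anti x y) // h // !inE eqxx.
  by rewrite -(anti y z) // h // !inE eqxx orbT.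
exists (fun x y => R x y && (x != y)); split.
- move=> x0; apply: contrapT => nx0.
  have [|z [[nz zmin] _]] := woR (fun x => `[< ~ Acc (fun x y => R x y && (x != y)) x >]).
    by exists x0; apply/asboolP.
  move/asboolP: nz; apply; constructor=> y /andP[yz /eqP ne].
  by apply: contrapT => ny; apply/ne/anti => //; apply/zmin/asboolP.
- move=> y x z /andP[xy nxy] /andP[yz nyz]; rewrite (trans _ _ _ xy yz) /=.
  by apply: contraNneq nxy => exz; apply/eqP/anti => //; rewrite exz.
- move=> x y; have [->|nxy] := eqVneq x y; first by constructor 2.
  by have /orP[h|h] := tot x y; [constructor 1|constructor 3]; rewrite h // eq_sym.
Qed.

Section LinearOrder.
Variables (M : eqType) (lt : rel M).
Hypothesis lt_irr : irreflexive lt.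
Hypothesis lt_trans : transitive lt.
Hypothesis lt_total : forall x y, [\/ lt x y, x = y | lt y x].

Lemma exists_sorted_subseq (s : seq M) : exists2 t, sorted lt t & t =i s.
Proof.
exists (sort (fun x y => (x == y) || lt x y) (undup s)); last first.
  by move=> x; rewrite mem_sort mem_undup.
have tle : transitive (fun x y => (x == y) || lt x y).
  move=> y x z /orP[/eqP->//|xy] /orP[/eqP<-|yz]; first by rewrite xy orbT.
  by rewrite (lt_trans xy yz) orbT.
have sle : sorted (fun x y => (x == y) || lt x y)
    (sort (fun x y => (x == y) || lt x y) (undup s)).
  apply: sort_sorted => x y; case: (lt_total x y) => [->|->|->]; rewrite ?eqxx ?orbT //.
have := undup_uniq s; rewrite -(sort_uniq (fun x y => (x == y) || lt x y)).
move: sle; rewrite (sorted_pairwise tle) (sorted_pairwise lt_trans).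
elim: (sort _ _) => //= x t IHt /andP[/allP h1 h2] /andP[xt ut].
rewrite IHt // andbT; apply/allP => y yt.
by have /orP[/eqP exy|//] := h1 y yt; rewrite exy yt in xt.
Qed.

(** So colourings of increasing lists are never vacuous on an infinite set. *)
Lemma exists_sorted (X : set M) n : embeds nat X ->
  exists s, [/\ size s = n, sorted lt s & within X s].
Proof.
move=> [f [finj fX]].
have [s srt es] := exists_sorted_subseq (map f (iota 0 n)).
exists s; split=> // [|x]; last by rewrite es => /mapP[i _ ->].
rewrite -(size_iota 0 n) -(size_map f); apply/perm_size/uniq_perm => //.
  exact: sorted_uniq srt.
by rewrite map_inj_uniq // iota_uniq.
Qed.
End LinearOrder.

(** * The beth hierarchy along a well-order *)

Lemma card_eq_embeds K L : [set: K] #= [set: L] -> embeds K [set: L].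
Proof. by move/card_eqPle=> [/card_le_embeds]. Qed.

Section Beth.
Variables (W : Type) (lt : W -> W -> Prop) (B : W -> Type).
Hypothesis lt_wf : well_founded lt.
Hypothesis lt_total : forall x y, lt x y \/ x = y \/ lt y x.
Hypothesis beth_B : beth_hierarchy lt B.

Lemma beth_succ v w : is_succ lt v w -> embeds (set (B v)) [set: B w].
Proof.
by move=> svw; have [_ /(_ _ _ svw) /card_esym /card_eq_embeds] := beth_B.
Qed.

(** At a successor, singletons embed a set in its power set; at a limit, the bound
    is part of the definition. *)
Lemma beth_mono v w : lt v w -> embeds (B v) [set: B w].
Proof.
elim: (lt_wf w) v => {}w _ IH v vw; have [_ Bsucc Blim] := beth_B.
case: (pselect (exists u, is_succ lt u w)) => [[u uw]|nsucc]; last first.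
  apply/card_le_embeds; have [|h _] := Blim w; last exact: h.
  by split=> [/(_ _ vw)|u uw]; last by apply: nsucc; exists u.
have uBw : embeds (B u) [set: B w].
  apply: embeds_trans _ (beth_succ uw); exists set1; split=> // x y e.
  by have : [set y] x by rewrite -e.
case: (lt_total v u) => [vu|[->//|uv]]; last by case: uw => _ /(_ v) [].
exact: embeds_trans (IH _ uw.1 _ vu) uBw.
Qed.

Lemma beth_infinite w : embeds nat [set: B w].
Proof.
elim: (lt_wf w) => {}w _ IH; have [B0 _ _] := beth_B.
case: (pselect (is_zero lt w)) => [/B0/card_esym/card_eq_embeds //|/existsNP[v /contrapT vw]].
exact: embeds_trans (IH _ vw) (beth_mono vw).
Qed.

End Beth.

Section LtTop.
Variable a : well_order.

Lemma lt_top_wf : well_founded (@lt_top a).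
Proof.
have acc x : Acc (@lt_top a) (Some x).
  by elim: (wlt_wf x) => {}x _ IH; constructor=> -[y /IH|].
by move=> [x|]; [apply: acc|constructor=> -[y _|//]].
Qed.

Lemma lt_top_total (x y : option a) : lt_top x y \/ x = y \/ lt_top y x.
Proof.
case: x y => [x|] [y|] /=; [|by left|by right; right|by right; left].
by have [h|[->|h]] := wlt_total x y; [left|right; left|right; right].
Qed.
End LtTop.

(** * Homogeneous values along a computable tree *)

(** The graph of [v] over four arguments, in the layout read by the constraints. *)
Definition four_points (i : seq nat) (v : nat -> nat) : seq nat :=
  [:: nth 0 i 0; v (nth 0 i 0); nth 0 i 1; v (nth 0 i 1);
      nth 0 i 2; v (nth 0 i 2); nth 0 i 3; v (nth 0 i 3)].

Definition respects (Q : seq nat -> bool) (I : set nat) (v : nat -> nat) : Prop :=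
  forall i, size i = 4 -> (forall j, j \in i -> I j) -> Q (four_points i v).

Section Tree.
Variable Q : seq nat -> bool.
Hypothesis recQ : recb 8 Q.

(** The finite sequences in which no violated constraint is visible. *)
Definition tree (s : seq nat) : bool :=
  let r := iota 0 (size s) in
  all (fun i1 => all (fun i2 => all (fun i3 => all (fun i4 =>
    Q (four_points [:: i1; i2; i3; i4] (nth 0 s))) r) r) r) r.

Lemma treeP s : reflect (respects Q [set i | i < size s] (nth 0 s)) (tree s).
Proof.
apply: (iffP idP) => [h [|i1 [|i2 [|i3 [|i4 []]]]] // _ ltI|h].
  have lt j : j \in [:: i1; i2; i3; i4] -> j \in iota 0 (size s).
    by move=> /ltI; rewrite mem_iota.
  apply: (allP (allP (allP (allP h i1 _) i2 _) i3 _) i4 _);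
    by apply: lt; rewrite !inE eqxx ?orbT.
apply/allP => i1; rewrite mem_iota => lt1; apply/allP => i2; rewrite mem_iota => lt2.
apply/allP => i3; rewrite mem_iota => lt3; apply/allP => i4; rewrite mem_iota => lt4.
by apply: h => // j; rewrite !inE => /or4P[] /eqP ->.
Qed.

Lemma tree_nil : tree [::]. Proof. by []. Qed.

Lemma eq_four_points i v w : size i = 4 -> {in i, v =1 w} -> four_points i v = four_points i w.
Proof. by move=> si vw; rewrite /four_points !vw // mem_nth ?si. Qed.

Lemma tree_prefix s x : tree (rcons s x) -> tree s.
Proof.
move=> /treeP h; apply/treeP => i si ltI.
have -> : four_points i (nth 0 s) = four_points i (nth 0 (rcons s x)).
  by apply: eq_four_points => // j /ltI /= lt; rewrite nth_rcons lt.
by apply: h => // j /ltI /= lt; rewrite size_rcons ltnW.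
Qed.

Lemma tree_branch (g : nat -> nat) : (forall n, tree (mkseq g n)) -> respects Q setT g.
Proof.
move=> Tg i si _; pose n := (\max_(j <- i) j).+1.
have lt j : j \in i -> j < n by move=> ji; rewrite ltnS; apply: leq_bigmax_seq.
have -> : four_points i g = four_points i (nth 0 (mkseq g n)).
  by apply: eq_four_points => // j /lt ltj; rewrite nth_mkseq.
by have /treeP h := Tg n; apply: h => // j /lt; rewrite size_mkseq.
Qed.

(** The bounds on the indices are relaxed from the length of the list to its
    code, with a guard, so that bounded quantification applies directly. *)
Lemma tree_computable : rec1 (fun c => tree (nseq_decode c)).
Proof.
pose P4 s := code_has (nth 0 s 4) (nth 0 s 0) ==>
  Q (four_points [:: nth 0 s 3; nth 0 s 2; nth 0 s 1; nth 0 s 0] (code_nth (nth 0 s 4))).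
pose P3 s := code_has (nth 0 s 3) (nth 0 s 0) ==> all (fun x => P4 (x :: s)) (iota 0 (nth 0 s 3)).
pose P2 s := code_has (nth 0 s 2) (nth 0 s 0) ==> all (fun x => P3 (x :: s)) (iota 0 (nth 0 s 2)).
pose P1 s := code_has (nth 0 s 1) (nth 0 s 0) ==> all (fun x => P2 (x :: s)) (iota 0 (nth 0 s 1)).
have r4 : recb 5 P4.
  apply: recb_imp; first by apply: recb_code_has; apply: rec_nth.
  pose G i s := if odd i then code_nth (nth 0 s 4) (nth 0 s (3 - i./2)) else nth 0 s (3 - i./2).
  have rG i : rec 5 (G i).
    by rewrite /G; case: odd; [apply: rec_code_nth|]; apply: rec_nth.
  exact: (@rec_comp_seq 5 8 _ G recQ (fun i _ => rG i)).
have r3 : recb 4 P3.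
  by apply: recb_imp; [apply: recb_code_has|apply: recb_all => //]; apply: rec_nth.
have r2 : recb 3 P2.
  by apply: recb_imp; [apply: recb_code_has|apply: recb_all => //]; apply: rec_nth.
have r1 : recb 2 P1.
  by apply: recb_imp; [apply: recb_code_has|apply: recb_all => //]; apply: rec_nth.
have guard (s : seq nat) (R : pred nat) :
    all (fun i => (i < size s) ==> R i) (iota 0 (nseq_code s)) = all R (iota 0 (size s)).
  rewrite -(subnKC (size_nseq_code s)) iotaD all_cat add0n [X in _ && X](_ : _ = true) ?andbT.
    by apply: eq_in_all => i; rewrite mem_iota => /= ->.
  by apply/allP => i; rewrite mem_iota => /andP[le _]; rewrite ltnNge le.
apply: eq_rec (recb_all r1 (rec_nth 1 0)) => c _; congr nat_of_bool.
have [s es] := nseq_code_surj (nth 0 c 0); rewrite -es nseq_codeK.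
rewrite /tree -guard; apply: eq_all => i1; rewrite /P1 /= -es code_hasE; congr implb.
rewrite -guard; apply: eq_all => i2; rewrite /P2 /= -es code_hasE; congr implb.
rewrite -guard; apply: eq_all => i3; rewrite /P3 /= -es code_hasE; congr implb.
rewrite -guard; apply: eq_all => i4; rewrite /P4 /= -es code_hasE; congr implb.
by rewrite /four_points /= !code_nthE.
Qed.

(** The functions [value i] are seen as colourings of increasing lists. *)
Definition homogeneous (arity : nat -> nat) (M : eqType) (lt : rel M)
    (value : nat -> seq M -> nat) (X : set M) (i c : nat) : Prop :=
  forall s, size s = arity i -> sorted lt s -> within X s -> value i s = c.

(** Colours that are constant on a common infinite set satisfy the constraints. *)
Definition realizes (arity : nat -> nat) (M : eqType) (lt : rel M)
    (value : nat -> seq M -> nat) : Prop :=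
  forall (X : set M) (I : set nat) (v : nat -> nat), embeds nat X ->
    (forall i, I i -> homogeneous arity lt value X i (v i)) -> respects Q I v.

Section Stretching.
Variables (arity : nat -> nat) (T_wf : ~ exists g, forall n, tree (mkseq g n)).

Definition stretching_order : well_order :=
  kb_omega tree_prefix T_wf.

Variables (M : eqType) (lt : rel M) (value : nat -> seq M -> nat).
Hypothesis lt_wf : well_founded lt.
Hypothesis lt_trans : transitive lt.
Hypothesis lt_total : forall x y, [\/ lt x y, x = y | lt y x].
Hypothesis M_realizes : realizes arity lt value.

(** Each node [s] is paired with a subset of [M] on which the coordinates below
    [size s] take the values prescribed by [s], and whose size is at least every
    beth number attached to [s].  Erdos-Rado, applied with the smallest of these
    as target, makes the next coordinate constant on a subset that is at least
    as large as every beth number attached to any child of [s], whatever the new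
    colour is.  So the child it determines is again such a node, and the descent
    never ends. *)
Lemma tree_descent : ~ has_card_beth M stretching_order.
Proof.
move=> [B [beth_B /card_esym/card_eq_embeds cardM]].
have Bmono := beth_mono (@lt_top_wf _) (@lt_top_total _) beth_B.
have Bsucc := beth_succ beth_B.
have Binf := beth_infinite (@lt_top_wf _) (@lt_top_total _) beth_B.
suff none s (Ts : tree s) (X : set M) : ~ [/\
    forall i, i < size s -> homogeneous arity lt value X i (nth 0 s i) &
    forall n, embeds (B (Some (exist tree s Ts, n))) X].
  apply: (none [::] tree_nil setT); split=> // n.
  exact: embeds_trans (Bmono (Some _) None I) cardM.
have acc := kb_wf tree_prefix T_wf Ts.
elim: acc Ts X => {}s _ IH Ts X [homX bigX].
(* The next coordinate to be made constant is the one indexed by [size s]. *)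
have [m er] := erdos_rado lt_wf lt_trans lt_total (arity (size s)).
pose b n : option stretching_order := Some (exist tree s Ts, n).
have powX : embeds (pow m (B (b 0))) X.
  apply: embeds_trans (bigX m); elim: m {er} => [|m [f [f_inj _]]].
    exact: embeds_inj (@inj_id _).
  apply: embeds_trans (embeds_inj (image_set_inj f_inj)) (Bsucc _ _ _).
  split=> [|[[[t Tt] k]|] [] //]; first by right.
  case=> [/= st|[/(congr1 val) /= est /= mk]] [/= ts|[/(congr1 val) /= ets /= km]].
  - by have := kb_lt_trans st ts; rewrite kb_ltxx.
  - by move: st; rewrite ets kb_ltxx.
  - by move: ts; rewrite est kb_ltxx.
  - by lia.
(* The target [B (b 0)] is above all beth numbers attached to the children. *)
have [Y [c [YX bigY homY]]] := er _ _ (value (size s)) (Binf _) powX.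
have homYc i : i < size (rcons s c) -> homogeneous arity lt value Y i (nth 0 (rcons s c) i).
  rewrite size_rcons ltnS leq_eqVlt nth_rcons => /orP[/eqP ->|lti].
    by rewrite ltnn eqxx.
  by rewrite lti => r sr srt wr; apply: homX => // x /wr /YX.
have Tc : tree (rcons s c).
  by apply/treeP; apply: (M_realizes (embeds_trans (Binf (b 0)) bigY)).
apply: (IH (rcons s c) (conj (kb_lt_rcons s c) Tc) Tc Y); split=> // n.
apply: embeds_trans _ bigY; apply: Bmono; left; exact: kb_lt_rcons.
Qed.

End Stretching.

Theorem exists_branch (arity : nat -> nat) :
  (forall a, lt_omega1CK a -> exists (M : eqType) (lt : rel M) (value : nat -> seq M -> nat),
     [/\ has_card_beth M a, well_founded lt, transitive lt,
         forall x y, [\/ lt x y, x = y | lt y x] & realizes arity lt value]) ->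
  exists g, respects Q setT g.
Proof.
move=> big; apply: contrapT => nog.
have T_wf : ~ exists g, forall n, tree (mkseq g n).
  by move=> [g /tree_branch Qg]; apply: nog; exists g.
have [|M [lt [value [cardM lwf ltr ltot rlz]]]] := big (stretching_order T_wf).
  apply: kb_omega_lt_omega1CK => //; exact: tree_computable.
exact: (@tree_descent arity T_wf M lt value lwf ltr ltot rlz cardM).
Qed.

End Tree.

(** * Embeddings and back-and-forth systems *)

Section Embeddings.
Variable tau : vocabulary.

Definition embedding M N (A : structure tau M) (B : structure tau N) (h : M -> N) : Prop :=
  [/\ injective h,
      forall (f : Defs.fsym tau) v, h (fint A (f := f) v) = fint B (h \o v) &
      forall (r : rsym tau) v, rint A (r := r) v <-> rint B (h \o v)].

Lemma embedding_comp M N L (A : structure tau M) (B : structure tau N) (C : structure tau L) h k :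
  embedding A B h -> embedding B C k -> embedding A C (k \o h).
Proof.
move=> [hinj hf hr] [kinj kf kr]; split; first exact: inj_comp.
- by move=> f v; rewrite /= hf kf.
- by move=> r v; rewrite hr kr.
Qed.

Lemma eval_embedding M N (A : structure tau M) (B : structure tau N) h V (e : V -> M) t :
  embedding A B h -> eval B (h \o e) t = h (eval A e t).
Proof.
move=> [_ hf _]; elim: t => //= f ts IH; rewrite hf; congr fint.
by apply/funext => i; apply: IH.
Qed.

Lemma atom_embedding M N (A : structure tau M) (B : structure tau N) h V (e : V -> M) a :
  embedding A B h -> atom_holds B (h \o e) a <-> atom_holds A e a.
Proof.
move=> emb; case: a => [t u|r ts] /=.
  by rewrite !(eval_embedding _ _ emb); have [hinj _ _] := emb; split=> [/hinj|->].
have [_ _ ->] := emb; suff -> : (fun i => eval B (h \o e) (ts i)) =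
   h \o (fun i => eval A e (ts i)) by [].
by apply/funext => i; rewrite (eval_embedding _ _ emb).
Qed.

Definition back_and_forth M N (A : structure tau M) (B : structure tau N)
    (R : forall n, ('I_n -> M) -> ('I_n -> N) -> Prop) : Prop :=
  forall n e e', R n e e' ->
    [/\ forall a, atom_holds A e a <-> atom_holds B e' a,
        forall x, exists y, R n.+1 (env_cons x e) (env_cons y e') &
        forall y, exists x, R n.+1 (env_cons x e) (env_cons y e')].

Lemma back_and_forth_sat M N (A : structure tau M) (B : structure tau N) R :
  back_and_forth A B R ->
  forall n (p : formula tau n) e e', R n e e' -> sat A p e <-> sat B p e'.
Proof.
move=> bf n p; elim: p => {n} /=.
- by move=> n a e e' /bf[].
- by move=> n p IH e e' /IH ->.
- by move=> n p IH e e' Re; split=> h k; have := IH k _ _ Re; have := h k; tauto.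
- by move=> n p IH e e' Re; split=> -[k h]; exists k; have := IH k _ _ Re; tauto.
- move=> n p IH e e' /bf[_ forth back]; split=> h x.
    by have [y Ry] := back x; apply/(IH _ _ Ry).
  by have [y Ry] := forth x; apply/(IH _ _ Ry).
- move=> n p IH e e' /bf[_ forth back]; split=> -[x h].
    by have [y Ry] := forth x; exists y; apply/(IH _ _ Ry).
  by have [y Ry] := back x; exists y; apply/(IH _ _ Ry).
Qed.

Lemma comp_env_cons M N (h : M -> N) n x (e : 'I_n -> M) :
  h \o env_cons x e = env_cons (h x) (h \o e).
Proof. by apply/funext => i; rewrite /env_cons /=; case: unlift. Qed.

End Embeddings.

(** * Clubs of subsets *)

Section Clubs.
Variable M : eqType.
Implicit Types (N : set M) (P Q : set (set M)).

(** Clubs are described by algebras with countably many operations, each of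
    which takes arguments of any length. *)
Definition closed_under (F : nat -> seq M -> M) N : Prop :=
  forall k s, within N s -> N (F k s).

Definition club P : Prop := exists F, forall N, closed_under F N -> P N.

Lemma club_sub P Q : club P -> (forall N, P N -> Q N) -> club Q.
Proof. by move=> [F h] PQ; exists F => N /h /PQ. Qed.

Lemma club_countable (I : countType) (P : I -> set (set M)) : inhabited M ->
  (forall i, club (P i)) -> club (fun N => forall i, P i N).
Proof.
move=> [x0] /choice[F h].
exists (fun k s => if unpickle (fstn k) is Some i then F i (sndn k) s else x0).
move=> N clN i; apply: h => k s ws.
by have := clN (npair (pickle i) k) s ws; rewrite fstn_pair sndn_pair pickleK.
Qed.

Lemma club_and P Q : inhabited M -> club P -> club Q -> club (fun N => P N /\ Q N).
Proof.
move=> iM cP cQ; have := @club_countable bool (fun b => if b then P else Q) iM.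
case=> [[]//|F h]; exists F => N /h hN; split; [exact: (hN true)|exact: (hN false)].
Qed.

(** The diagonal intersection: an operation for [P x] is applied by passing [x]
    as an extra argument. *)
Lemma club_diagonal (P : M -> set (set M)) : inhabited M ->
  (forall x, club (P x)) -> club (fun N => forall x, N x -> P x N).
Proof.
move=> [x0] /choice[F h].
exists (fun k s => if s is x :: s' then F x k s' else x0).
move=> N clN x Nx; apply: h => k s ws; apply: (clN k (x :: s)) => y.
by rewrite in_cons => /orP[/eqP ->|/ws].
Qed.

Lemma club_diagonal_seq (P : seq M -> set (set M)) : inhabited M ->
  (forall s, club (P s)) -> club (fun N => forall s, within N s -> P s N).
Proof.
move=> iM cP.
have cn (n : nat) : club (fun N => forall s, size s = n -> within N s -> P s N).
  elim: n P cP => [|n IHn] P cP.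
    by apply: club_sub (cP [::]) _ => N h [].
  have /(club_diagonal iM) cQ x := IHn (fun s => P (x :: s)) (fun s => cP (x :: s)).
  apply: club_sub cQ _ => N h [//|x s] [ss] ws; apply: h => // [|y ys]; apply: ws.
    exact: mem_head.
  by rewrite in_cons ys orbT.
by apply: club_sub (club_countable iM cn) _ => N h s; apply: h.
Qed.

Lemma club_mem x : club (fun N => N x).
Proof. by exists (fun _ _ => x) => N /(_ 0 [::]); apply. Qed.

Lemma club_fun (f : seq M -> M) : club (fun N => forall s, within N s -> N (f s)).
Proof. by exists (fun _ => f) => N /(_ 0). Qed.

Definition hull (F : nat -> seq M -> M) (s : seq M) : set M :=
  [set x | forall N, within N s -> closed_under F N -> N x].

Lemma hull_within F s : within (hull F s) s.
Proof. by move=> x xs N ws _; apply: ws. Qed.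

Lemma hull_closed F s : closed_under F (hull F s).
Proof. by move=> k t wt N ws clN; apply: (clN) => x /wt; exact. Qed.

Lemma hull_sub F s t : {subset s <= t} -> hull F s `<=` hull F t.
Proof. by move=> st x hx N wt clN; apply: hx => [y /st /wt|]. Qed.

(** Every element of the hull is the value of a finitely branching term whose
    nodes are labelled by natural numbers. *)
Lemma hull_countable F s : inhabited M -> countable (hull F s).
Proof.
move=> [x0]; pose ev := fix ev (t : GenTree.tree nat) : M := match t with
  | GenTree.Leaf i => nth x0 s i
  | GenTree.Node k ts => F k (map ev ts) end.
suff /subset_card_le/card_le_trans : hull F s `<=` range ev.
  by apply; apply: card_le_trans (card_image_le _ _) (countableP _).
move=> x; apply=> [y ys|k t wt].
  by exists (GenTree.Leaf (index y s)) => //=; rewrite nth_index.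
have /choice[g gP] : forall y, exists u, y \in t -> ev u = y.
  move=> y; case: (boolP (y \in t)) => [/wt[u _ <-]|_]; first by exists u.
  by exists (GenTree.Leaf 0).
exists (GenTree.Node k (map g t)) => //=; rewrite -map_comp; congr F.
by rewrite -[RHS]map_id; apply/eq_in_map => y /= /gP.
Qed.

End Clubs.

(** * Countable elementary submodels *)

Section Substructures.
Variables (tau : vocabulary) (M : eqType) (B : structure tau M).

Definition fun_closed (N : set M) : Prop :=
  forall (f : Defs.fsym tau) v, (forall i, N (v i)) -> N (fint B (f := f) v).

Lemma substructure_closed (N : set M) (Nfun : fun_closed N)
    (f : Defs.fsym tau) (v : 'I_(farity f) -> N) :
  fint B (fun i => set_val (v i)) \in N.
Proof. by apply/mem_set/Nfun => i; apply: set_mem; apply: valP. Qed.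

Definition substructure (N : set M) (N0 : inhabited N) (Nfun : fun_closed N) :
    structure tau N :=
  Structure N0 (fun f v => SigSub (substructure_closed Nfun (f := f) v))
    (fun r v => rint B (r := r) (fun i => set_val (v i))).

Lemma substructure_embedding (N : set M) (N0 : inhabited N) (Nfun : fun_closed N) :
  embedding (substructure N0 Nfun) B set_val.
Proof. by split=> //; apply: val_inj. Qed.

Let M_inh : inhabited M := universe_nonempty B.

Lemma club_fun_closed : club fun_closed.
Proof.
have [x0] := M_inh.
have h (f : Defs.fsym tau) : club (fun N : set M => forall v, (forall i, N (v i)) -> N (fint B (f := f) v)).
  apply: club_sub (club_fun (fun s => fint B (f := f) (fun i => nth x0 s i))) _ => N h v Nv.
  have := h (map v (enum 'I_(farity f))).
  rewrite (_ : (fun i => _) = v) => [|//].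
    by apply=> y /mapP[i _ ->].
  by apply/funext => i; rewrite (nth_map i) ?size_enum_ord // nth_ord_enum.
by apply: club_sub (club_countable M_inh h) _.
Qed.

(** Elementarity for a single infinitary formula; it holds on a club because
    only countably many witness functions are involved. *)
Definition elementary_at n (p : formula tau n) (N : set M) : Prop :=
  forall (N0 : inhabited N) (Nfun : fun_closed N) (e : 'I_n -> N),
    sat (substructure N0 Nfun) p e <-> sat B p (set_val \o e).

Lemma club_witness n (P : ('I_n -> M) -> M -> Prop) :
  club (fun N => forall e : 'I_n -> M, (forall i, N (e i)) ->
    (exists x, P e x) -> exists2 x, N x & P e x).
Proof.
have [x0] := M_inh.
have /choice[w wP] : forall e, exists y, (exists x, P e x) -> P e y.
  move=> e; case: (pselect (exists x, P e x)) => [[x Px]|nP]; first by exists x.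
  by exists x0.
apply: club_sub (club_fun (fun s => w (fun i => nth x0 s i))) _ => N h e Ne ex.
exists (w e); last exact: wP.
have := h (map e (enum 'I_n)); rewrite (_ : (fun i => _) = e).
  by apply=> y /mapP[i _ ->].
by apply/funext => i; rewrite (nth_map i) ?size_enum_ord // nth_ord_enum.
Qed.

Lemma club_elementary n (p : formula tau n) : club (elementary_at p).
Proof.
have [x0] := M_inh; elim: p => {n}.
- move=> n a; exists (fun _ _ => x0) => N _ N0 Nfun e /=.
  have := atom_embedding e a (substructure_embedding N0 Nfun); tauto.
- move=> n p IH; apply: club_sub IH _ => N IH N0 Nfun e /=.
  by have := IH N0 Nfun e; tauto.
- move=> n p /(club_countable M_inh) IH; apply: club_sub IH _ => N IH N0 Nfun e /=.
  by split=> h k; apply/IH.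
- move=> n p /(club_countable M_inh) IH; apply: club_sub IH _ => N IH N0 Nfun e /=.
  by split=> -[k h]; exists k; apply/IH.
- move=> n p IH.
  have cw := club_witness (fun (e : 'I_n -> M) x => ~ sat B p (env_cons x e)).
  apply: club_sub (club_and M_inh IH cw) _ => N [{}IH {}cw] N0 Nfun e /=.
  split=> h x; last by apply/IH; rewrite comp_env_cons.
  apply: contrapT => nx; have [i||y Ny] := cw (set_val \o e).
  + by apply: set_mem; apply: valP.
  + by exists x.
  + apply; have /IH := h (SigSub (mem_set Ny)).
    by rewrite comp_env_cons.
- move=> n p IH.
  have cw := club_witness (fun (e : 'I_n -> M) x => sat B p (env_cons x e)).
  apply: club_sub (club_and M_inh IH cw) _ => N [{}IH {}cw] N0 Nfun e /=.
  split=> -[x h]; first by exists (set_val x); move/IH: h; rewrite comp_env_cons.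
  have [i||y Ny hy] := cw (set_val \o e).
  + by apply: set_mem; apply: valP.
  + by exists x.
  + by exists (SigSub (mem_set Ny)); apply/IH; rewrite comp_env_cons.
Qed.

End Substructures.

(** * Copies of a countable structure inside a model of its Scott sentence *)

Section Copies.
Variables (tau : vocabulary) (U : set nat) (A : structure tau U) (phi : sentence tau).
Hypothesis scott_phi : scott_sentence A phi.
Variables (M : eqType) (B : structure tau M).
Hypothesis B_phi : models B phi.

Let M_inh : inhabited M := universe_nonempty B.

(** Countable elementary submodels satisfy [phi], hence are copies of [A]. *)
Lemma club_copy : club (fun N : set M => countable N ->
  exists2 h : U -> M, embedding A B h & range h = N).
Proof.
have [x0] := M_inh.
apply: club_sub (club_and M_inh (club_and M_inh (club_mem x0) (club_fun_closed B))
   (club_elementary B phi)) _ => N [[Nx0 Nfun] el] cN.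
have N0 : inhabited N by constructor; exact: SigSub (mem_set Nx0).
have cNT : countable [set: N] by apply: card_le_trans cN; have /card_eqPle[] := card_setT N.
have : models (substructure N0 Nfun) phi by move=> e; apply/el/B_phi.
move/(scott_phi _ cNT) => [g [[g' gK g'K] gf gr]].
exists (set_val \o g').
  apply: embedding_comp (substructure_embedding N0 Nfun); split.
  - exact: can_inj g'K.
  - move=> f v; apply: (can_inj gK); rewrite g'K gf; congr fint.
    by apply/funext => i; rewrite /= g'K.
  - move=> r v; rewrite gr; suff -> : g \o (g' \o v) = v by [].
    by apply/funext => i; rewrite /= g'K.
apply/seteqP; split=> [_ [u _ <-]|x Nx] /=; first by apply: set_mem; apply: valP.
by exists (g (SigSub (mem_set Nx))) => //=; rewrite gK.
Qed.

(** The finite partial maps [l] that extend to stationarily many copies of [A]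
    inside [M].  By pressing down, they form a back-and-forth system between
    [A] and [M], whatever the cardinality of [M]. *)
Definition matches (l : seq (U * M)) : Prop := forall P, club P ->
  exists h : U -> M, [/\ embedding A B h, P (range h) & forall p, p \in l -> h p.1 = p.2].

(** Fodor's argument: if every value [x] at [a] were excluded by a club, a copy in
    the diagonal intersection of these clubs would contradict the club that
    belongs to its own value at [a]. *)
Lemma matches_forth l a : matches l -> exists x, matches ((a, x) :: l).
Proof.
move=> ml; apply: contrapT => /forallNP nex.
have /choice[P hP] : forall x, exists P, club P /\ ~ exists h : U -> M,
    [/\ embedding A B h, P (range h) & forall p, p \in (a, x) :: l -> h p.1 = p.2].
  by move=> x; have /existsNP[P /not_implyP h] := nex x; exists P.
have [h [emb Ph hl]] := ml _ (club_diagonal M_inh (fun x => (hP x).1)).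
have [_ []] := hP (h a); exists h; split=> //; first by apply: Ph; exists a.
by move=> p; rewrite in_cons => /orP[/eqP ->|/hl].
Qed.

(** Here countable completeness suffices, since [A] is countable. *)
Lemma matches_back l x : matches l -> exists a, matches ((a, x) :: l).
Proof.
move=> ml; apply: contrapT => /forallNP nex.
have /choice[P hP] : forall a, exists P, club P /\ ~ exists h : U -> M,
    [/\ embedding A B h, P (range h) & forall p, p \in (a, x) :: l -> h p.1 = p.2].
  by move=> a; have /existsNP[P /not_implyP h] := nex a; exists P.
have [h [emb [[a _ ha] Ph] hl]] := ml _ (club_and M_inh (club_mem x)
  (club_countable M_inh (fun a => (hP a).1))).
have [_ []] := hP a; exists h; split=> // p.
by rewrite in_cons => /orP[/eqP ->|/hl].
Qed.

Definition good_copy (h : U -> M) : Prop :=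
  embedding A B h /\ forall s : seq U, matches [seq (a, h a) | a <- s].

(** There are too many lists over [M] for a plain intersection, but the clubs that
    refute [matches] can be intersected diagonally, as a copy only has to avoid
    the refutations of lists lying in its own range. *)
Lemma club_good : club (fun N => forall h : U -> M,
  embedding A B h -> range h = N -> good_copy h).
Proof.
have [x0] := M_inh.
have /choice[P hP] : forall l, exists P, club P /\ (matches l \/ ~ exists h : U -> M,
    [/\ embedding A B h, P (range h) & forall p, p \in l -> h p.1 = p.2]).
  move=> l; case: (pselect (matches l)) => [ml|/existsNP[P /not_implyP[cP nP]]].
    by exists setT; split; [exists (fun _ _ => x0)|left].
  by exists P; split=> //; right.
have c (s : seq U) := club_diagonal_seq M_inh (fun t => (hP (zip s t)).1).
apply: club_sub (club_countable M_inh c) _ => N hN h emb eN; split=> // s.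
have wN : within N (map h s) by move=> y /mapP[a _ ->]; rewrite -eN; exists a.
have {hN} := hN s _ wN.
have -> : zip s (map h s) = [seq (a, h a) | a <- s] by elim: s {wN} => //= a s ->.
rewrite -eN => Ph; have [_ [//|[]]] := hP [seq (a, h a) | a <- s].
by exists h; split=> // p /mapP[a _ ->].
Qed.

Definition automorphism (p q : U -> U) : Prop :=
  [/\ cancel p q, cancel q p & embedding A A p].

(** Two partial maps into [M] with the same values: composing one with the inverse
    of the other is a finite partial isomorphism of [A]. *)
Definition linked (l : seq (U * U * M)) : Prop :=
  matches [seq (t.1.1, t.2) | t <- l] /\ matches [seq (t.1.2, t.2) | t <- l].

Lemma linked_step l (n : nat) : linked l -> exists l', [/\ linked l', {subset l <= l'} &
  forall u : U, set_val u = n ->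
    (exists b x, (u, b, x) \in l') /\ (exists a x, (a, u, x) \in l')].
Proof.
move=> ll; case: (pselect (exists u : U, set_val u = n)) => [[u un]|nu]; last first.
  by exists l; split=> // u un; case: nu; exists u.
have [x m1] := matches_forth u ll.1; have [b m2] := matches_back x ll.2.
(* [u] has been added to the domain; it is added to the range next. *)
have l1 : linked ((u, b, x) :: l) by [].
have [y m3] := matches_forth u l1.2; have [a m4] := matches_back y l1.1.
exists [:: (a, u, y), (u, b, x) & l]; split=> // [t tl|u' u'n].
  by rewrite !in_cons tl !orbT.
have -> : u' = u by apply: val_inj; apply: etrans u'n (esym un).
by split; [exists b, x|exists a, y]; rewrite !in_cons eqxx ?orbT.
Qed.

Lemma linked_copies l : linked l -> exists h1 h2 : U -> M,
  [/\ embedding A B h1, embedding A B h2 &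
      forall t, t \in l -> h1 t.1.1 = t.2 /\ h2 t.1.2 = t.2].
Proof.
have cT : club (setT : set (set M)) by have [x0] := M_inh; exists (fun _ _ => x0).
move=> [/(_ _ cT)[h1 [emb1 _ h1l]] /(_ _ cT)[h2 [emb2 _ h2l]]].
exists h1, h2; split=> // t tl; split.
  by apply: (h1l (t.1.1, t.2)); apply/mapP; exists t.
by apply: (h2l (t.1.2, t.2)); apply/mapP; exists t.
Qed.

(** The usual construction in omega steps; each stage is witnessed by two copies
    of [A] in [M], through which the symbols of the vocabulary are transported. *)
Lemma linked_automorphism l : linked l -> exists p q,
  automorphism p q /\ forall t, t \in l -> p t.1.1 = t.1.2.
Proof.
move=> ll.
have /choice[nx nxP] : forall k : nat * seq (U * U * M), exists l', linked k.2 ->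
    [/\ linked l', {subset k.2 <= l'} & forall u : U, set_val u = k.1 ->
     (exists b x, (u, b, x) \in l') /\ (exists a x, (a, u, x) \in l')].
  move=> [n k]; case: (pselect (linked k)) => [lk|nk]; last by exists [::].
  by have [l' l'P] := linked_step n lk; exists l'.
pose st := fix st n := if n is m.+1 then nx (m, st m) else l.
have st_linked n : linked (st n) by elim: n => //= n /(nxP (n, _))[].
have st_sub n m : n <= m -> {subset st n <= st m}.
  move/subnK <-; elim: (m - n) => // k IHk t /IHk; rewrite addSn /=.
  by have [_ h _] := nxP (k + n, st (k + n)) (st_linked _); apply: h.
(* The limit of the stages is the graph of the automorphism, with third entries
   in [M] as witnesses. *)
pose L t := exists n, t \in st n.
have L_stage (s : seq (U * U * M)) : (forall t, t \in s -> L t) -> exists n, {subset s <= st n}.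
  elim: s => [|t s IHs] Ls; first by exists 0.
  have [m hm] : exists n, {subset s <= st n}.
    by apply: IHs => t' ts; apply: Ls; rewrite in_cons ts orbT.
  have [n hn] := Ls t (mem_head _ _); exists (maxn n m) => t'.
  rewrite in_cons => /orP[/eqP ->|/hm]; first exact: st_sub (leq_maxl n m) _ hn.
  exact/st_sub/leq_maxr.
have L_copies (s : seq (U * U * M)) : (forall t, t \in s -> L t) -> exists h1 h2 : U -> M,
  [/\ embedding A B h1, embedding A B h2 &
      forall t, t \in s -> h1 t.1.1 = t.2 /\ h2 t.1.2 = t.2].
  move=> /L_stage[n sn]; have [h1 [h2 [e1 e2 h]]] := linked_copies (st_linked n).
  by exists h1, h2; split=> // t /sn /h.
have L_eq t t' : L t -> L t' -> t.1.1 = t'.1.1 <-> t.1.2 = t'.1.2.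
  move=> Lt Lt'; have [|h1 [h2 [[i1 _ _] [i2 _ _] h]]] := L_copies [:: t; t'].
    by move=> t1; rewrite !inE => /orP[]/eqP ->.
  have [e1 e2] := h t (mem_head _ _); have [|e3 e4] := h t'.
    by rewrite !inE eqxx orbT.
  split=> e; first by apply: i2; rewrite e2 e4 -e1 -e3 e.
  by apply: i1; rewrite e1 e3 -e2 -e4 e.
have /choice[p pP] : forall u, exists b, exists x, L (u, b, x).
  move=> u; have [_ _ /(_ u erefl) [[b [x h]] _]] := nxP (set_val u, st (set_val u)) (st_linked _).
  by exists b, x, (set_val u).+1.
have /choice[q qP] : forall u, exists a, exists x, L (a, u, x).
  move=> u; have [_ _ /(_ u erefl) [_ [a [x h]]]] := nxP (set_val u, st (set_val u)) (st_linked _).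
  by exists a, x, (set_val u).+1.
have L_p t : L t -> p t.1.1 = t.1.2.
  by move=> Lt; have [x Lx] := pP t.1.1; have [/(_ erefl)] := L_eq _ _ Lx Lt.
have pK : cancel p q.
  move=> u; have [x Lx] := pP u; have [y Ly] := qP (p u).
  by have [_ /(_ erefl) /esym] := L_eq _ _ Lx Ly.
have qK : cancel q p.
  by move=> u; have [y Ly] := qP u; have := L_p _ Ly.
exists p, q; split; last by move=> t tl; apply: L_p; exists 0.
split=> //; have /choice[x xP] := pP.
have copies n (v : 'I_n -> U) w : exists h1 h2 : U -> M,
    [/\ embedding A B h1, embedding A B h2, h1 w = x w, h2 (p w) = x w &
        (h1 \o v = x \o v) /\ (h2 \o (p \o v) = x \o v)].
  pose s := [seq (u, p u, x u) | u <- w :: codom v].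
  have [|h1 [h2 [e1 e2 h]]] := L_copies s; first by move=> t /mapP[u _ ->]; apply: xP.
  have hu u : u \in w :: codom v -> h1 u = x u /\ h2 (p u) = x u.
    by move=> us; apply: (h (u, p u, x u)); apply: map_f.
  have [ew1 ew2] := hu w (mem_head _ _).
  exists h1, h2; split=> //; split; apply/funext => i /=.
    by have [] := hu (v i); rewrite // in_cons codom_f orbT.
  by have [] := hu (v i); rewrite // in_cons codom_f orbT.
split; first exact: can_inj pK.
- move=> f v; have [h1 [h2 [[_ f1 _] [i2 f2 _] e1 e2 [ev1 ev2]]]] := copies _ v (fint A v).
  by apply: i2; rewrite e2 -e1 f1 ev1 f2 ev2.
- move=> r v; have [u0] := universe_nonempty A.
  have [h1 [h2 [[_ _ r1] [_ _ r2] _ _ [ev1 ev2]]]] := copies _ v u0.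
  by rewrite r1 ev1 r2 ev2.
Qed.

Lemma good_copies_conjugate (h k : U -> M) (e : U -> U) (s : seq U) :
  good_copy h -> good_copy k -> (forall a, h (e a) = k a) ->
  exists p q, automorphism p q /\ {in s, p =1 e}.
Proof.
move=> [_ gh] [_ gk] he; pose l := [seq (a, e a, k a) | a <- s].
have [|p [q [pq pl]]] := @linked_automorphism l.
  split; rewrite /l -map_comp; first exact: gk.
  by have := gh (map e s); rewrite -map_comp; under eq_map => a do rewrite /= he.
by exists p, q; split=> // a as_; apply: (pl (a, e a, k a)); apply: map_f.
Qed.

(** A single algebra [F] generates the hulls, which makes them increase with the
    finite set. *)
Lemma good_hulls : exists (H : seq M -> U -> M),
  [/\ forall s, good_copy (H s), forall s x, x \in s -> range (H s) x &
      forall s t, {subset s <= t} -> range (H s) `<=` range (H t)].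
Proof.
have [F hF] := club_and M_inh club_copy club_good.
have /choice[H HP] : forall s, exists h : U -> M, embedding A B h /\ range h = hull F s.
  move=> s; have [/(_ (hull_countable F s M_inh))[h emb eh] _] := hF _ (@hull_closed _ F s).
  by exists h.
exists H; split=> [s|s x xs|s t st].
- have [_ g] := hF _ (@hull_closed _ F s); have [emb eh] := HP s; exact: g.
- by have [_ ->] := HP s; apply: hull_within.
- by have [_ ->] := HP s; have [_ ->] := HP t; apply: hull_sub.
Qed.

End Copies.

(** * Goedel numbers *)

Section Codes.
Variables (tau : vocabulary) (U : set nat).

Lemma term_code_inj : injective (@term_code tau U).
Proof.
elim=> [x|f ts IH] [y|g us] /=; try by case/npair_inj.
  by case/npair_inj => _ /val_inj ->.
case/npair_inj => _ /npair_inj [/val_inj efg]; subst g.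
move=> /nseq_code_inj /eq_in_map e; congr App; apply/funext => i.
by apply/IH/e; rewrite mem_enum.
Qed.

Lemma atom_code_inj : injective (@atom_code tau U).
Proof.
move=> [t u|r ts] [t' u'|r' ts'] /=; try by case/npair_inj.
  by case/npair_inj => _ /npair_inj [/term_code_inj -> /term_code_inj ->].
case/npair_inj => _ /npair_inj [/val_inj er]; subst r'.
move=> /nseq_code_inj /eq_in_map e; congr ARel; apply/funext => i.
by apply/term_code_inj/e; rewrite mem_enum.
Qed.

Fixpoint term_map V W (f : V -> W) (t : term tau V) : term tau W :=
  match t with
  | Var x => Var tau (f x)
  | App g ts => App (fun i => term_map f (ts i))
  end.

Definition atom_map V W (f : V -> W) (a : atom tau V) : atom tau W :=
  match a with
  | AEq t u => AEq (term_map f t) (term_map f u)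
  | ARel r ts => ARel (fun i => term_map f (ts i))
  end.

Lemma eval_term_map M (A : structure tau M) V W (f : V -> W) (e : W -> M) t :
  eval A e (term_map f t) = eval A (e \o f) t.
Proof.
by elim: t => //= g ts IH; congr fint; apply/funext => i; apply: IH.
Qed.

Lemma atom_holds_map M (A : structure tau M) V W (f : V -> W) (e : W -> M) a :
  atom_holds A e (atom_map f a) <-> atom_holds A (e \o f) a.
Proof.
case: a => [t u|r ts] /=; first by rewrite !eval_term_map.
suff -> : (fun i => eval A e (term_map f (ts i))) = (fun i => eval A (e \o f) (ts i)) by [].
by apply/funext => i; rewrite eval_term_map.
Qed.

Variable A : structure tau U.

Lemma diagram_inv t q : atomic_diagram A (npair t q) -> exists a, q = atom_code a /\
  (atom_holds A id a /\ t = 1 \/ ~ atom_holds A id a /\ t = 0).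
Proof.
by move=> [a [] [h /npair_inj[-> ->]]]; exists a; split=> //; [left|right].
Qed.

Lemma diagram_true a : atomic_diagram A (npair 1 (atom_code a)) <-> atom_holds A id a.
Proof.
split=> [/diagram_inv[b [/atom_code_inj -> []]] []//|h].
by exists a; left.
Qed.

Lemma diagram_false a : atomic_diagram A (npair 0 (atom_code a)) <-> ~ atom_holds A id a.
Proof.
split=> [/diagram_inv[b [/atom_code_inj -> []]] []//|h].
by exists a; right.
Qed.

Lemma diagram_map t (p : U -> U) a : embedding A A p ->
  atomic_diagram A (npair t (atom_code a)) ->
  atomic_diagram A (npair t (atom_code (atom_map p a))).
Proof.
move=> emb /diagram_inv[b [/atom_code_inj <- h]].
have e : atom_holds A id (atom_map p a) <-> atom_holds A id a.
  by rewrite atom_holds_map; apply: (atom_embedding id).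
case: h => [] [h ->]; first by apply/diagram_true/e.
by apply/diagram_false; rewrite e.
Qed.

Lemma diagram_elem x : U x <->
  atomic_diagram A (npair 1 (npair 0 (npair (npair 0 x) (npair 0 x)))).
Proof.
split=> [Ux|/diagram_inv[[t u|r ts] /= [/npair_inj[//] _]]].
  have := diagram_true (AEq (Var tau (SigSub (mem_set Ux))) (Var tau (SigSub (mem_set Ux)))).
  by case=> _; apply.
move=> /npair_inj [+ _] _; case: t => [y|f ts] /npair_inj [//] _ ->.
by apply: set_mem; apply: valP.
Qed.

(** Values outside [U] are kept, since coordinates are indexed by all numbers. *)
Definition extend (p : U -> U) (x : nat) : nat := oapp (fun u => set_val (p u)) x (insub x).

Lemma extend_val p u : extend p (set_val u) = set_val (p u).
Proof. by rewrite /extend valK. Qed.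

(** The action of [p] on codes of terms.  It is defined on all of them, and not only
    on codes of elements, so that it respects the diagram without any syntactic
    side condition. *)
Definition term_code_map (p : U -> U) (k : nat) : nat :=
  if pselect (exists t, term_code t = k) is left ex
  then term_code (term_map p (projT1 (cid ex))) else k.

Lemma term_code_mapE p t : term_code_map p (term_code t) = term_code (term_map p t).
Proof.
rewrite /term_code_map; case: pselect => [ex|[]]; last by exists t.
by case: cid => u /= /term_code_inj ->.
Qed.

Definition list_map (p : U -> U) (l : nat) : nat :=
  nseq_code (map (term_code_map p) (nseq_decode l)).

Lemma list_mapE p s : list_map p (nseq_code s) = nseq_code (map (term_code_map p) s).
Proof. by rewrite /list_map nseq_codeK. Qed.

Lemma diagram_rel_map t p r l : embedding A A p ->
  atomic_diagram A (npair t (npair 1 (npair r l))) ->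
  atomic_diagram A (npair t (npair 1 (npair r (list_map p l)))).
Proof.
move=> emb h; have [[u v|s ts] /= [e _]] := diagram_inv h.
  by case/npair_inj: e.
case/npair_inj: e => _ /npair_inj [er el].
rewrite er el in h *; have := diagram_map (a := ARel ts) emb h.
rewrite /= list_mapE -map_comp; congr (atomic_diagram _ (npair _ (npair _ (npair _ (nseq_code _))))).
by apply: eq_map => i /=; rewrite term_code_mapE.
Qed.

Lemma diagram_fun_map p f l w : embedding A A p ->
  atomic_diagram A (npair 1 (npair 0 (npair (npair 1 (npair f l)) (npair 0 w)))) ->
  atomic_diagram A (npair 1 (npair 0 (npair (npair 1 (npair f (list_map p l))) (npair 0 (extend p w))))).
Proof.
move=> emb h; have [[t u|s ts] /= [e _]] := diagram_inv h; last by case/npair_inj: e.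
case/npair_inj: e => _ /npair_inj []; case: t => [x|g ts] /= /npair_inj[] // _.
move=> /npair_inj[ef el]; case: u => [x|? ?] /= /npair_inj[] // _ ew.
rewrite ef el ew in h; have := diagram_map (a := AEq (App ts) (Var tau x)) emb h.
rewrite ef el ew extend_val /= list_mapE -map_comp.
congr (atomic_diagram _ (npair _ (npair _ (npair (npair _ (npair _ (nseq_code _))) _)))).
by apply: eq_map => i /=; rewrite term_code_mapE.
Qed.

End Codes.

(** * Composition of masks *)

(** Masks are lists of numbers in which 0 means false and any other entry true.
    [mask_comp b c] is the mask selecting, in a list filtered by [b], the entries
    kept by [c]; it is undefined if the length of [c] is not the number of entries
    kept by [b]. *)
Fixpoint mask_comp (b c : seq nat) : option (seq nat) :=
  match b, c with
  | [::], [::] => Some [::]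
  | [::], _ :: _ => None
  | 0 :: b, c => omap (cons 0) (mask_comp b c)
  | _.+1 :: _, [::] => None
  | _.+1 :: b, x :: c => omap (cons x) (mask_comp b c)
  end.

Definition sel T (b : seq nat) (s : seq T) : seq T := mask (map (fun x => 0 < x) b) s.

Lemma mask_compP b c d : mask_comp b c = Some d ->
  [/\ size d = size b, size c = count (fun x => 0 < x) b &
      forall T (s : seq T), sel d s = sel c (sel b s)].
Proof.
elim: b c d => [|[|x] b IHb] [|y c] d //=.
- by case=> <-; split.
- case e: mask_comp => [d'|] //= [<-] /=; have [-> ec sl] := IHb _ _ e.
  by split=> // T [|z s]; [rewrite /sel !mask0|apply: sl].
- case e: mask_comp => [d'|] //= [<-] /=; have [-> ec sl] := IHb _ _ e.
  by split=> // T [|z s]; [rewrite /sel !mask0|apply: sl].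
- case e: mask_comp => [d'|] //= [<-] /=; have [-> -> sl] := IHb _ _ e.
  split=> // T [|z s]; first by rewrite /sel !mask0.
  by case: y => [|y]; [apply: sl|congr cons; apply: sl].
Qed.

Definition mask_comp_code (b c : nat) : nat :=
  if mask_comp (nseq_decode b) (nseq_decode c) is Some d then (nseq_code d).+1 else 0.

(** * The constraints on a blueprint *)

(** A blueprint is coded by its values at the coordinates [coord t x y]:
    - [t = 0]: the composition table of masks, [x] and [y] being codes of masks,
      with 0 for undefined and the successor of the code otherwise;
    - [t = 1], [t = 2]: an automorphism and its inverse at the element [y];
    - [t = 3]: the action of this automorphism on the code [y] of a list of terms;
    - [t = 4]: the embedding attached to the mask with code [x], at the element [y];
    - [t = 5]: the distinguished point.
    For [t] from 1 to 3 the number [x] is a pair [npair b k], and the automorphism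
    coincides below [k] with the embedding attached to the mask [b].
    Tables that could be computed ([t = 0], [t = 3]) are made part of the data, so
    that each constraint is local: it never needs a recursion. *)
Definition coord (t x y : nat) : nat := npair t (npair x y).
Definition itag (i : nat) : nat := fstn i.
Definition ifst (i : nat) : nat := fstn (sndn i).
Definition isnd (i : nat) : nat := sndn (sndn i).

Lemma itagE t x y : itag (coord t x y) = t. Proof. exact: fstn_pair. Qed.
Lemma ifstE t x y : ifst (coord t x y) = x.
Proof. by rewrite /ifst sndn_pair fstn_pair. Qed.
Lemma isndE t x y : isnd (coord t x y) = y.
Proof. by rewrite /isnd !sndn_pair. Qed.
Section Constraints.
Variable D : nat -> bool.

Definition elem (x : nat) : bool := D (npair 1 (npair 0 (npair (npair 0 x) (npair 0 x)))).

Definition hd (l : nat) : nat := fstn l.-1.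
Definition tl (l : nat) : nat := sndn l.-1.
Definition some_cons (x v : nat) : nat := if v == 0 then 0 else (npair x v.-1).+2.

Definition c_comp_nil (i v : nat) : bool := (i == coord 0 0 0) ==> (v == 1).
Definition c_comp_nil_cons (i v : nat) : bool :=
  [&& itag i == 0, ifst i == 0 & 0 < isnd i] ==> (v == 0).
Definition c_comp_skip (i1 v1 i2 v2 : nat) : bool :=
  [&& itag i1 == 0, 0 < ifst i1, hd (ifst i1) == 0 & i2 == coord 0 (tl (ifst i1)) (isnd i1)]
  ==> (v1 == some_cons 0 v2).
Definition c_comp_cons_nil (i v : nat) : bool :=
  [&& itag i == 0, 0 < ifst i, 0 < hd (ifst i) & isnd i == 0] ==> (v == 0).
Definition c_comp_keep (i1 v1 i2 v2 : nat) : bool :=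
  [&& itag i1 == 0, 0 < ifst i1, 0 < hd (ifst i1), 0 < isnd i1 &
      i2 == coord 0 (tl (ifst i1)) (tl (isnd i1))]
  ==> (v1 == some_cons (hd (isnd i1)) v2).

Definition c_functor (i1 v1 i2 v2 i3 v3 i4 v4 : nat) : bool :=
  [&& itag i1 == 0, 0 < v1, elem (isnd i2), i2 == coord 4 (isnd i1) (isnd i2),
      i3 == coord 4 (ifst i1) v2 & i4 == coord 4 v1.-1 (isnd i2)]
  ==> (v3 == v4).

Definition c_point (i v : nat) : bool := (itag i == 5) ==> elem v.
Definition c_point_apart (i1 v1 i2 v2 i3 v3 : nat) : bool :=
  [&& i1 == coord 5 0 0, i2 == coord 4 (nseq_code [:: 1; 0]) v1 &
      i3 == coord 4 (nseq_code [:: 0; 1]) v1]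
  ==> (v2 != v3).

Definition c_agree (i1 v1 i2 v2 : nat) : bool :=
  [&& itag i1 == 1, isnd i1 < sndn (ifst i1), elem (isnd i1) &
      i2 == coord 4 (fstn (ifst i1)) (isnd i1)]
  ==> (v1 == v2).
Definition c_elem (i v : nat) : bool :=
  [&& (itag i == 1) || (itag i == 2) & elem (isnd i)] ==> elem v.
Definition c_cancel (i1 v1 i2 v2 : nat) : bool :=
  [&& itag i1 == 1, elem (isnd i1) & i2 == coord 2 (ifst i1) v1]
  ==> (v2 == isnd i1).
Definition c_cancel' (i1 v1 i2 v2 : nat) : bool :=
  [&& itag i1 == 2, elem (isnd i1) & i2 == coord 1 (ifst i1) v1]
  ==> (v2 == isnd i1).

Definition c_list_nil (i v : nat) : bool := [&& itag i == 3 & isnd i == 0] ==> (v == 0).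
Definition c_list_cons (i1 v1 i2 v2 i3 v3 : nat) : bool :=
  [&& itag i1 == 3, 0 < isnd i1, fstn (hd (isnd i1)) == 0, elem (sndn (hd (isnd i1))),
      i2 == coord 1 (ifst i1) (sndn (hd (isnd i1))) &
      i3 == coord 3 (ifst i1) (tl (isnd i1))]
  ==> (v1 == (npair (npair 0 v2) v3).+1).
(** In this clause and the next, [i2] or [i3] is used as a bare number, which ranges
    over everything because every number is an index. *)
Definition c_rel (i1 v1 i2 : nat) : bool :=
  [&& itag i1 == 3 & D (npair (fstn i2) (npair 1 (npair (sndn i2) (isnd i1))))]
  ==> D (npair (fstn i2) (npair 1 (npair (sndn i2) v1))).
Definition c_fun (i1 v1 i2 v2 i3 : nat) : bool :=
  [&& itag i1 == 3, i2 == coord 1 (ifst i1) (isnd i2) &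
      D (npair 1 (npair 0 (npair (npair 1 (npair i3 (isnd i1))) (npair 0 (isnd i2)))))]
  ==> D (npair 1 (npair 0 (npair (npair 1 (npair i3 v1)) (npair 0 v2)))).

Definition constraints (s : seq nat) : bool :=
  let x := nth 0 s in
  [&& c_comp_nil (x 0) (x 1), c_comp_nil_cons (x 0) (x 1),
      c_comp_skip (x 0) (x 1) (x 2) (x 3), c_comp_cons_nil (x 0) (x 1),
      c_comp_keep (x 0) (x 1) (x 2) (x 3),
      c_functor (x 0) (x 1) (x 2) (x 3) (x 4) (x 5) (x 6) (x 7),
      c_point (x 0) (x 1), c_point_apart (x 0) (x 1) (x 2) (x 3) (x 4) (x 5),
      c_agree (x 0) (x 1) (x 2) (x 3), c_elem (x 0) (x 1),
      c_cancel (x 0) (x 1) (x 2) (x 3), c_cancel' (x 0) (x 1) (x 2) (x 3),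
      c_list_nil (x 0) (x 1), c_list_cons (x 0) (x 1) (x 2) (x 3) (x 4) (x 5),
      c_rel (x 0) (x 1) (x 2) & c_fun (x 0) (x 1) (x 2) (x 3) (x 4)].

Lemma recb_app1 n F : rec1 D -> rec n F -> recb n (fun s => D (F s)).
Proof. exact: rec_app1. Qed.

Lemma rec_coord n F G H : rec n F -> rec n G -> rec n H ->
  rec n (fun s => coord (F s) (G s) (H s)).
Proof. by move=> rF rG rH; apply: rec_pair => //; apply: rec_pair. Qed.
Lemma rec_itag n F : rec n F -> rec n (fun s => itag (F s)).
Proof. exact: rec_fst. Qed.
Lemma rec_ifst n F : rec n F -> rec n (fun s => ifst (F s)).
Proof. by move/rec_snd/rec_fst. Qed.
Lemma rec_isnd n F : rec n F -> rec n (fun s => isnd (F s)).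
Proof. by move/rec_snd/rec_snd. Qed.
Lemma rec_hd n F : rec n F -> rec n (fun s => hd (F s)).
Proof. by move/rec_pred/rec_fst. Qed.
Lemma rec_tl n F : rec n F -> rec n (fun s => tl (F s)).
Proof. by move/rec_pred/rec_snd. Qed.
Lemma rec_some_cons n F G : rec n F -> rec n G -> rec n (fun s => some_cons (F s) (G s)).
Proof.
move=> rF rG; apply: rec_if; [apply: recb_eq => //; exact: rec_const|exact: rec_const|].
by apply/rec_S/rec_S/rec_pair => //; apply: rec_pred.
Qed.
Lemma recb_elem n F : rec1 D -> rec n F -> recb n (fun s => elem (F s)).
Proof.
move=> rD rF; apply: recb_app1 => //.
do !(apply: rec_pair; first exact: rec_const).
by apply: rec_pair; apply: rec_pair => //; apply: rec_const.
Qed.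

Ltac rec_tac rD := repeat first
 [ exact: rec_nth | exact: rec_const | exact: rD
 | apply: recb_imp | apply: recb_and | apply: recb_or | apply: recb_not
 | apply: recb_lt | apply: recb_eq | apply: recb_elem | apply: (recb_app1 rD)
 | apply: rec_coord | apply: rec_itag | apply: rec_ifst | apply: rec_isnd
 | apply: rec_hd | apply: rec_tl | apply: rec_some_cons | apply: rec_pair
 | apply: rec_fst | apply: rec_snd | apply: rec_pred | apply: rec_S ].

Lemma recb_constraints : rec1 D -> recb 8 constraints.
Proof.
move=> rD; rewrite /constraints.
do !apply: recb_and; rewrite /c_comp_nil /c_comp_nil_cons /c_comp_skip /c_comp_cons_nil
 /c_comp_keep /c_functor /c_point /c_point_apart /c_agree /c_elem /c_cancel /c_cancel'
 /c_list_nil /c_list_cons /c_rel /c_fun.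
all: rec_tac rD.
Qed.
End Constraints.

(** * Models satisfy the constraints *)

Definition diagram_dec (tau : vocabulary) (U : set nat) (A : structure tau U) (k : nat) : bool :=
  `[< atomic_diagram A k >].

Lemma diagram_dec_computable (tau : vocabulary) (U : set nat) (A : structure tau U) :
  computable_structure A -> rec1 (diagram_dec A).
Proof. by move/computable_setP. Qed.

Lemma elemP (tau : vocabulary) (U : set nat) (A : structure tau U) x :
  reflect (exists u : U, x = set_val u) (elem (diagram_dec A) x).
Proof.
apply: (iffP (asboolP _)) => [h|[u ->]].
  by have Ux := (diagram_elem A x).2 h; exists (SigSub (mem_set Ux)).
by apply/(diagram_elem A); apply: set_mem; apply: valP.
Qed.

Lemma nseq_code_hd_tl x : 0 < x -> x = nseq_code (hd x :: nseq_decode (tl x)).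
Proof. by case: x => // x _; rewrite /= nseq_decodeK /hd /tl npairK. Qed.

Lemma mask_comp_codeE b c : mask_comp_code (nseq_code b) (nseq_code c) =
  if mask_comp b c is Some d then (nseq_code d).+1 else 0.
Proof. by rewrite /mask_comp_code !nseq_codeK. Qed.

(** The coordinates that belong to the mask [b] are computed in the hull of a list as
    long as [b]. *)
Definition arity (i : nat) : nat :=
  match itag i with
  | 1 | 2 | 3 => size (nseq_decode (fstn (ifst i)))
  | 4 => size (nseq_decode (ifst i))
  | 5 => 1
  | _ => 0
  end.

(** The embedding [E s b] is the inclusion of the hull of the sublist [sel b s] in
    the hull of [s], read in [A] through the isomorphisms [H]. *)
Section Realization.
Variables (tau : vocabulary) (U : set nat) (A : structure tau U) (M : eqType) (lt : rel M).
Hypothesis lt_irr : irreflexive lt.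
Hypothesis lt_trans : transitive lt.
Hypothesis lt_total : forall x y, [\/ lt x y, x = y | lt y x].
Variables (H : seq M -> U -> M) (E : seq M -> seq nat -> U -> U) (pt : M -> U).
Variables (p q : seq M -> nat -> U -> U).
Hypothesis H_inj : forall s, injective (H s).
Hypothesis HE : forall s b u, H s (E s b u) = H (sel b s) u.
Hypothesis Hpt : forall x, H [:: x] (pt x) = x.
Hypothesis p_aut : forall s c, automorphism A (p s c) (q s c).
Hypothesis pE : forall s c u, set_val u < sndn c -> p s c u = E s (nseq_decode (fstn c)) u.

Let D := diagram_dec A.

Definition value (i : nat) (s : seq M) : nat :=
  match itag i with
  | 0 => mask_comp_code (ifst i) (isnd i)
  | 1 => extend (p s (ifst i)) (isnd i)
  | 2 => extend (q s (ifst i)) (isnd i)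
  | 3 => list_map tau (p s (ifst i)) (isnd i)
  | 4 => extend (E s (nseq_decode (ifst i))) (isnd i)
  | _ => if s is x :: _ then set_val (pt x) else 0
  end.

Variable X : set M.
Hypothesis X_infinite : embeds nat X.

Let val_at (i v : nat) : Prop := homogeneous arity lt value X i v.

Let some_sorted n : exists s, [/\ size s = n, sorted lt s & within X s].
Proof. exact: exists_sorted. Qed.

Lemma val_comp i v : itag i = 0 -> val_at i v -> v = mask_comp_code (ifst i) (isnd i).
Proof. by move=> ti /(_ [::]); rewrite /arity /value ti => ->. Qed.

Lemma homogeneous_comp_nil i v : val_at i v -> c_comp_nil i v.
Proof.
move=> vi; apply/implyP => /eqP ei; rewrite (val_comp _ vi) ei ?itagE // ifstE isndE.
by rewrite (mask_comp_codeE [::] [::]).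
Qed.

Lemma homogeneous_comp_nil_cons i v : val_at i v -> c_comp_nil_cons i v.
Proof.
move=> vi; apply/implyP => /and3P[/eqP ti /eqP xi yi]; rewrite (val_comp ti vi) xi.
by rewrite (nseq_code_hd_tl yi) (mask_comp_codeE [::]).
Qed.

Lemma homogeneous_comp_skip i1 v1 i2 v2 : val_at i1 v1 -> val_at i2 v2 -> c_comp_skip i1 v1 i2 v2.
Proof.
move=> h1 h2; apply/implyP => /and4P[/eqP t1 x1 /eqP hx1 /eqP ei2].
rewrite (val_comp t1 h1) (val_comp _ h2) ei2 ?itagE // ifstE isndE.
rewrite {1}(nseq_code_hd_tl x1) hx1 -{1}[isnd i1]nseq_decodeK mask_comp_codeE /=.
by rewrite /mask_comp_code; case: mask_comp.
Qed.

Lemma homogeneous_comp_cons_nil i v : val_at i v -> c_comp_cons_nil i v.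
Proof.
move=> vi; apply/implyP => /and4P[/eqP ti xi hi /eqP yi]; rewrite (val_comp ti vi) yi.
by rewrite (nseq_code_hd_tl xi) (mask_comp_codeE _ [::]) /=; case: (hd _) hi.
Qed.

Lemma homogeneous_comp_keep i1 v1 i2 v2 : val_at i1 v1 -> val_at i2 v2 -> c_comp_keep i1 v1 i2 v2.
Proof.
move=> h1 h2; apply/implyP => /and5P[/eqP t1 x1 hx1 y1 /eqP ei2].
rewrite (val_comp t1 h1) (val_comp _ h2) ei2 ?itagE // ifstE isndE.
rewrite {1}(nseq_code_hd_tl x1) {1}(nseq_code_hd_tl y1) mask_comp_codeE /mask_comp_code /=.
by case: (hd (ifst i1)) hx1 => // k _; case: mask_comp.
Qed.

Let val_E i v x y s : val_at i v -> i = coord 4 x y ->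
  size s = size (nseq_decode x) -> sorted lt s -> within X s ->
  v = extend (E s (nseq_decode x)) y.
Proof.
move=> vi ei ss srt ws; have := vi s; rewrite /arity /value ei itagE ifstE isndE.
by move=> ->.
Qed.

Lemma sel_sorted b s : sorted lt s -> sorted lt (sel b s).
Proof. exact/sorted_mask. Qed.

Lemma sel_within b s : within X s -> within X (sel b s).
Proof. by move=> ws x /mem_mask /ws. Qed.

(** Evaluating all three embeddings on one list [s] of [X] and on its sublist
    [sel b s] is possible because the values are the same for every increasing
    list of [X] of the right length; then the equation says that inclusions of
    hulls compose. *)
Lemma homogeneous_functor i1 v1 i2 v2 i3 v3 i4 v4 :
  val_at i1 v1 -> val_at i2 v2 -> val_at i3 v3 -> val_at i4 v4 ->
  c_functor D i1 v1 i2 v2 i3 v3 i4 v4.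
Proof.
move=> h1 h2 h3 h4; apply/implyP => /and5P[/eqP t1 v1_gt0 /elemP[u eu] /eqP e2 /andP[/eqP e3 /eqP e4]].
have := val_comp t1 h1; rewrite /mask_comp_code; case ebc : mask_comp => [d|] ev1; last first.
  by rewrite ev1 in v1_gt0.
have [sd sc selE] := mask_compP ebc; rewrite ev1 /= in e4.
have [s [ss srt ws]] := some_sorted (size (nseq_decode (ifst i1))).
rewrite (val_E h4 e4 (s := s)) ?nseq_codeK ?ss // (val_E h3 e3 ss) //.
rewrite (val_E h2 e2 (s := sel (nseq_decode (ifst i1)) s)); last exact: sel_within.
- by rewrite eu !extend_val; apply/eqP; congr set_val; apply: (H_inj (s := s)); rewrite !HE selE.
- by rewrite size_mask ?size_map // count_map sc.
- exact: sel_sorted.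
Qed.

Lemma val_point i v x : val_at i v -> itag i = 5 -> X x -> v = set_val (pt x).
Proof.
move=> vi ti Xx; rewrite -(vi [:: x]) /arity /value ?ti //.
by move=> y; rewrite inE => /eqP ->.
Qed.

Lemma homogeneous_point i v : val_at i v -> c_point D i v.
Proof.
move=> vi; apply/implyP => /eqP ti; have [f [_ fX]] := X_infinite.
by rewrite (val_point vi ti (fX 0)); apply/elemP; exists (pt (f 0)).
Qed.

(** The two images of [pt x] and [pt y], which have the same value by homogeneity,
    are the entries of the list [x; y], and these differ. *)
Lemma homogeneous_point_apart i1 v1 i2 v2 i3 v3 :
  val_at i1 v1 -> val_at i2 v2 -> val_at i3 v3 -> c_point_apart i1 v1 i2 v2 i3 v3.
Proof.
move=> h1 h2 h3; apply/implyP => /and3P[/eqP e1 /eqP e2 /eqP e3].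
have [s [+ srt ws]] := some_sorted 2; case: s srt ws => [|x [|y []]] // srt ws _.
rewrite (val_E h2 e2 (s := [:: x; y])) ?(val_E h3 e3 (s := [:: x; y])) ?nseq_codeK //.
have t1 : itag i1 = 5 by rewrite e1 itagE.
have Xx : X x by apply: ws; rewrite !inE eqxx.
have Xy : X y by apply: ws; rewrite !inE eqxx orbT.
rewrite {1}(val_point h1 t1 Xx) (val_point h1 t1 Xy) !extend_val.
apply/eqP => /val_inj /(congr1 (H [:: x; y])); rewrite !HE /sel /= !Hpt => exy.
by move: srt; rewrite /= exy lt_irr.
Qed.

Let val_p i v t s : val_at i v -> itag i = t -> (0 < t < 4) ->
  size s = size (nseq_decode (fstn (ifst i))) -> sorted lt s -> within X s ->
  v = value i s.
Proof.
move=> vi ti lt_t ss srt ws; rewrite (vi s) // /arity ti.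
by case: t {ti} lt_t => [|[|[|[|]]]].
Qed.

Let val_c i v t x y s : val_at i v -> i = coord t x y -> (0 < t < 4) ->
  size s = size (nseq_decode (fstn x)) -> sorted lt s -> within X s ->
  v = value (coord t x y) s.
Proof.
by move=> vi ei lt_t ss srt ws; rewrite -ei; apply: (val_p vi (t := t)); rewrite // ei ?itagE ?ifstE.
Qed.

Lemma homogeneous_agree i1 v1 i2 v2 : val_at i1 v1 -> val_at i2 v2 -> c_agree D i1 v1 i2 v2.
Proof.
move=> h1 h2; apply/implyP => /and4P[/eqP t1 lt1 /elemP[u eu] /eqP e2].
have [s [ss srt ws]] := some_sorted (size (nseq_decode (fstn (ifst i1)))).
rewrite (val_E h2 e2 ss) // (val_p h1 t1 isT ss) // /value t1 eu !extend_val.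
by rewrite pE // -eu.
Qed.

Lemma homogeneous_elem i v : val_at i v -> c_elem D i v.
Proof.
move=> vi; apply/implyP => /andP[ti /elemP[u eu]].
have [s [ss srt ws]] := some_sorted (size (nseq_decode (fstn (ifst i)))).
case/orP: ti => /eqP ti; rewrite (val_p vi ti isT ss) // /value ti eu extend_val;
  by apply/elemP; eexists.
Qed.

Lemma homogeneous_cancel i1 v1 i2 v2 : val_at i1 v1 -> val_at i2 v2 -> c_cancel D i1 v1 i2 v2.
Proof.
move=> h1 h2; apply/implyP => /and3P[/eqP t1 /elemP[u eu] /eqP e2].
have [s [ss srt ws]] := some_sorted (size (nseq_decode (fstn (ifst i1)))).
rewrite (val_c h2 e2 isT ss) // /value itagE ifstE isndE.
rewrite (val_p h1 t1 isT ss) // /value t1 eu !extend_val.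
by have [-> _ _] := p_aut s (ifst i1).
Qed.

Lemma homogeneous_cancel' i1 v1 i2 v2 : val_at i1 v1 -> val_at i2 v2 -> c_cancel' D i1 v1 i2 v2.
Proof.
move=> h1 h2; apply/implyP => /and3P[/eqP t1 /elemP[u eu] /eqP e2].
have [s [ss srt ws]] := some_sorted (size (nseq_decode (fstn (ifst i1)))).
rewrite (val_c h2 e2 isT ss) // /value itagE ifstE isndE.
rewrite (val_p h1 t1 isT ss) // /value t1 eu !extend_val.
by have [_ -> _] := p_aut s (ifst i1).
Qed.

Lemma homogeneous_list_nil i v : val_at i v -> c_list_nil i v.
Proof.
move=> vi; apply/implyP => /andP[/eqP ti /eqP yi].
have [s [ss srt ws]] := some_sorted (size (nseq_decode (fstn (ifst i)))).
by rewrite (val_p vi ti isT ss) // /value ti yi (list_mapE tau _ [::]).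
Qed.

Lemma homogeneous_list_cons i1 v1 i2 v2 i3 v3 :
  val_at i1 v1 -> val_at i2 v2 -> val_at i3 v3 -> c_list_cons D i1 v1 i2 v2 i3 v3.
Proof.
move=> h1 h2 h3; apply/implyP => /and5P[/eqP t1 y1 /eqP hd0 /elemP[u eu] /andP[/eqP e2 /eqP e3]].
have [s [ss srt ws]] := some_sorted (size (nseq_decode (fstn (ifst i1)))).
rewrite (val_c h2 e2 isT ss) // (val_c h3 e3 isT ss) //.
rewrite /value !itagE !ifstE !isndE (val_p h1 t1 isT ss) // /value t1.
rewrite {1}(nseq_code_hd_tl y1) list_mapE /= -list_mapE nseq_decodeK.
rewrite -{1}[hd (isnd i1)]npairK hd0 eu extend_val.
by rewrite -[npair 0 (set_val u)]/(term_code (Var tau u)) term_code_mapE.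
Qed.

Lemma homogeneous_rel i1 v1 i2 : val_at i1 v1 -> c_rel D i1 v1 i2.
Proof.
move=> h1; apply/implyP => /andP[/eqP t1 /asboolP h].
have [s [ss srt ws]] := some_sorted (size (nseq_decode (fstn (ifst i1)))).
rewrite (val_p h1 t1 isT ss) // /value t1; apply/asboolP.
by apply: diagram_rel_map h; have [] := p_aut s (ifst i1).
Qed.

Lemma homogeneous_fun i1 v1 i2 v2 i3 : val_at i1 v1 -> val_at i2 v2 -> c_fun D i1 v1 i2 v2 i3.
Proof.
move=> h1 h2; apply/implyP => /and3P[/eqP t1 /eqP e2 /asboolP h].
have [s [ss srt ws]] := some_sorted (size (nseq_decode (fstn (ifst i1)))).
rewrite (val_c h2 e2 isT ss) // /value itagE ifstE isndE.
rewrite (val_p h1 t1 isT ss) // /value t1; apply/asboolP.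
by apply: diagram_fun_map h; have [] := p_aut s (ifst i1).
Qed.

Lemma homogeneous_constraints (I : set nat) (v : nat -> nat) :
  (forall i, I i -> val_at i (v i)) -> respects (constraints D) I v.
Proof.
move=> vI [|i1 [|i2 [|i3 [|i4 []]]]] // _ iI.
have h1 : val_at i1 (v i1) by apply/vI/iI; rewrite !inE eqxx.
have h2 : val_at i2 (v i2) by apply/vI/iI; rewrite !inE eqxx orbT.
have h3 : val_at i3 (v i3) by apply/vI/iI; rewrite !inE eqxx !orbT.
have h4 : val_at i4 (v i4) by apply/vI/iI; rewrite !inE eqxx !orbT.
rewrite /four_points /constraints /=.
rewrite homogeneous_comp_nil ?homogeneous_comp_nil_cons ?homogeneous_comp_skip //=.
rewrite homogeneous_comp_cons_nil ?homogeneous_comp_keep ?homogeneous_functor //=.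
rewrite homogeneous_point ?homogeneous_point_apart ?homogeneous_agree //=.
rewrite homogeneous_elem ?homogeneous_cancel ?homogeneous_cancel' //=.
by rewrite homogeneous_list_nil ?homogeneous_list_cons ?homogeneous_rel ?homogeneous_fun.
Qed.

End Realization.

Theorem model_realizes (tau : vocabulary) (U : set nat) (A : structure tau U)
    (phi : sentence tau) (M : eqType) (B : structure tau M) (lt : rel M) :
  scott_sentence A phi -> models B phi -> irreflexive lt -> transitive lt ->
  (forall x y, [\/ lt x y, x = y | lt y x]) ->
  exists value, realizes (constraints (diagram_dec A)) arity lt value.
Proof.
move=> scott_phi B_phi lt_irr lt_trans lt_total.
have [H [gH Hs Hsub]] := good_hulls scott_phi B_phi.
have H_inj s : injective (H s) by have [[]] := gH s.
have /choice[E0 HE] : forall a : seq M * seq nat * U, exists w, H a.1.1 w = H (sel a.1.2 a.1.1) a.2.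
  move=> [[s b] u] /=; have sub : {subset sel b s <= s} by move=> x /mem_mask.
  have [|w _ hw] := Hsub _ _ sub (H (sel b s) u); first by exists u.
  by exists w.
have /choice[pt Hpt] : forall x, exists u, H [:: x] u = x.
  by move=> x; have [|u _ hu] := Hs [:: x] x; [rewrite inE|exists u].
have /choice[pq pqP] : forall a : seq M * nat, exists pq : (U -> U) * (U -> U),
    automorphism A pq.1 pq.2 /\ forall u : U, set_val u < sndn a.2 ->
      pq.1 u = E0 (a.1, nseq_decode (fstn a.2), u).
  move=> [s c] /=; have [p [q [pq pe]]] := good_copies_conjugate
    (e := fun u => E0 (s, nseq_decode (fstn c), u)) (pmap insub (iota 0 (sndn c)))
    (gH s) (gH (sel (nseq_decode (fstn c)) s)) (fun u => HE (s, _, u)).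
  exists (p, q); split=> //= u lt_u; apply: pe.
  by rewrite mem_pmap_sub mem_iota.
exists (value tau (fun s b u => E0 (s, b, u)) pt
  (fun s c => (pq (s, c)).1) (fun s c => (pq (s, c)).2)).
move=> X I v Xinf; apply: (@homogeneous_constraints _ _ A M lt lt_irr lt_trans lt_total H) => //.
- by move=> s b u; rewrite (HE (s, b, u)).
- by move=> s c; have [] := pqP (s, c).
- by move=> s c u lt_u; have [_ ->] := pqP (s, c).
Qed.

(** * Finite sequences over an infinite set *)

(** A pair is stored as two entries, the first one being one of two fixed
    elements. *)
Lemma seq_bool_embeds K : embeds (seq K) [set: K] -> embeds (seq (bool * K)) [set: K].
Proof.
move=> [j [j_inj _]]; pose c (b : bool) := if b then j [::] else j [:: j [::]].
have c_inj : injective c by move=> [] [] // /j_inj.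
apply: (embeds_inj (f := fun s => j (flatten [seq [:: c p.1; p.2] | p <- s]))).
move=> s t /j_inj; elim: s t => [|[b x] s IHs] [|[b' x'] t] //= [/c_inj -> -> /IHs ->] //.
Qed.

Section SeqEmbeds.
Variable X : eqType.

Definition seq_inj_base (G : set (seq X * X)) : set X := [set x | exists z, G ([:: x], z)].

(** [G] is the graph of an injection of the finite sequences over the set
    [seq_inj_base G] into this same set; the set is read off from [G] so that
    Zorn's lemma can be applied to graphs alone. *)
Definition seq_inj (G : set (seq X * X)) : Prop :=
  [/\ forall s z, G (s, z) -> within (seq_inj_base G) s /\ seq_inj_base G z,
      forall s, within (seq_inj_base G) s -> exists z, G (s, z),
      forall s z z', G (s, z) -> G (s, z') -> z = z' &
      forall s s' z, G (s, z) -> G (s', z) -> s = s'].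

Lemma seq_inj_bigcup (F : set (set (seq X * X))) :
  (forall G, F G -> seq_inj G) -> total_on F subset -> F !=set0 ->
  seq_inj (\bigcup_(G in F) G).
Proof.
move=> Fok Ftot [G0 FG0].
have base_sub G : F G -> seq_inj_base G `<=` seq_inj_base (\bigcup_(G in F) G).
  by move=> FG x [z Gxz]; exists z, G.
have common p p' : (\bigcup_(G in F) G) p -> (\bigcup_(G in F) G) p' ->
    exists G, [/\ F G, G p & G p'].
  move=> [G FG Gp] [G' FG' Gp']; have [h|h] := Ftot _ _ FG FG'.
    by exists G'; split=> //; apply: h.
  by exists G; split=> //; apply: h.
split.
- move=> s z [G FG Gsz]; have [/(_ _ _ Gsz)[ws wz] _ _ _] := Fok _ FG.
  by split=> [x /ws|]; apply: (base_sub _ FG).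
- move=> s ws; suff [G FG wG] : exists2 G, F G & within (seq_inj_base G) s.
    have [_ /(_ _ wG)[z Gsz] _ _] := Fok _ FG.
    by exists z, G.
  elim: s ws => [|x s IHs] ws; first by exists G0.
  have [|G FG wG] := IHs; first by move=> y ys; apply: ws; rewrite in_cons ys orbT.
  have [z [G' FG' Gx]] := ws x (mem_head _ _).
  have [h|h] := Ftot _ _ FG FG'.
    exists G' => // y; rewrite in_cons => /orP[/eqP ->|/wG [w]]; first by exists z.
    by exists w; apply: h.
  exists G => // y; rewrite in_cons => /orP[/eqP ->|/wG //].
  by exists z; apply: h.
- move=> s z z' h h'; have [G [FG Gz Gz']] := common _ _ h h'.
  by have [_ _ f _] := Fok _ FG; apply: f Gz Gz'.
- move=> s s' z h h'; have [G [FG Gz Gz']] := common _ _ h h'.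
  by have [_ _ _ f] := Fok _ FG; apply: f Gz Gz'.
Qed.

Lemma seq_inj_nat : embeds nat [set: X] -> exists G, seq_inj G.
Proof.
move=> [u [u_inj _]]; have mu_inj := inj_map u_inj.
exists [set p | exists l, p = (map u l, u (nseq_code l))].
have baseE x : seq_inj_base [set p | exists l, p = (map u l, u (nseq_code l))] x <-> exists n, x = u n.
  split=> [[z [[|n l] [] // ->]]|[n ->]]; first by exists n.
  by exists (u (nseq_code [:: n])), [:: n].
split.
- move=> s z [l [-> ->]]; split=> [x /mapP[n _ ->]|]; apply/baseE; by eexists.
- move=> s ws; suff [l ->] : exists l, s = map u l by exists (u (nseq_code l)), l.
  elim: s ws => [|x s IHs] ws; first by exists [::].
  have [|l ->] := IHs; first by move=> y ys; apply: ws; rewrite in_cons ys orbT.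
  by have /baseE[n ->] := ws x (mem_head _ _); exists (n :: l).
- by move=> s z z' [l [-> ->]] [l' [/mu_inj -> ->]].
- by move=> s s' z [l [-> ->]] [l' [-> /u_inj/nseq_code_inj ->]].
Qed.

Lemma seq_inj_embeds G : seq_inj G -> embeds (seq (seq_inj_base G)) [set: seq_inj_base G].
Proof.
move=> [Gbase Gdom _ Ginj].
have /choice[j jP] : forall l : seq (seq_inj_base G), exists z : seq_inj_base G,
    G (map set_val l, set_val z).
  move=> l; have [|z Gz] := Gdom (map set_val l).
    by move=> x /mapP[y _ ->]; apply: set_mem; apply: valP.
  by exists (SigSub (mem_set (Gbase _ _ Gz).2)).
apply: (embeds_inj (f := j)) => l l' e; apply: (inj_map val_inj).
by apply: Ginj (jP l) _; rewrite e; apply: jP.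
Qed.

(** If the base [Y] has a disjoint copy, the sequences over the union of both embed
    in those over pairs (bit, element of [Y]), hence in [Y]; those that are new are
    sent into the copy. *)
Lemma seq_inj_extend G (f : seq_inj_base G -> X) : seq_inj G -> injective f ->
  (forall k, ~ seq_inj_base G (f k)) -> exists2 G', G `<` G' & seq_inj G'.
Proof.
move=> okG f_inj fN; have [Gbase Gdom Gfun Ginj] := okG.
set Y := seq_inj_base G in f f_inj fN Gbase Gdom *.
have [j [j_inj _]] := seq_bool_embeds (seq_inj_embeds okG).
pose Y' := [set x | Y x \/ exists k, x = f k].
have /choice[c cP] : forall x, exists p : bool * Y, Y' x ->
    x = if p.1 then set_val p.2 else f p.2.
  move=> x; case: (pselect (Y' x)) => [[Yx|[k ->]]|nY].
  - by exists (true, SigSub (mem_set Yx)).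
  - by exists (false, k).
  - have [z Gz] : exists z, G ([::], z) by apply: Gdom.
    by exists (true, SigSub (mem_set (Gbase _ _ Gz).2)).
have c_inj s t : within Y' s -> within Y' t -> map c s = map c t -> s = t.
  elim: s t => [|x s IHs] [|y t] //= ws wt [e es]; congr cons.
    apply: etrans (cP x (ws _ (mem_head _ _))) _; rewrite e.
    by apply/esym/cP/wt/mem_head.
  by apply: IHs => // z zs; [apply: ws|apply: wt]; rewrite in_cons zs orbT.
pose G' := G `|` [set p | [/\ within Y' p.1, ~ within Y p.1 & p.2 = f (j (map c p.1))]].
have baseE x : seq_inj_base G' x <-> Y' x.
  split=> [[z [Gxz|[/= w1 _ _]]]|[[z Gxz]|[k ->]]].
  - by left; exists z.
  - by apply: w1; rewrite mem_head.
  - by exists z; left.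
  - exists (f (j (map c [:: f k]))); right; split=> //= [y|h].
      by rewrite inE => /eqP ->; right; exists k.
    by apply: (fN k); apply: h; rewrite mem_head.
exists G'.
  split=> [|h]; first by move=> p Gp; left.
  have [z Gz] : exists z, G ([::], z) by apply: Gdom.
  pose k : Y := SigSub (mem_set (Gbase _ _ Gz).2).
  have /baseE[w /h Gw] : Y' (f k) by right; exists k.
  by apply: (fN k); exists w.
split.
- move=> s z [/Gbase[ws Yz]|[/= ws _ ->]]; split.
  + by move=> x /ws Yx; apply/baseE; left.
  + by apply/baseE; left.
  + by move=> x /ws Yx; apply/baseE.
  + by apply/baseE; right; eexists.
- move=> s ws; case: (pselect (within Y s)) => [/Gdom[z Gz]|nws]; first by exists z; left.
  exists (f (j (map c s))); right; split=> // x /ws; exact: (baseE x).1.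
- move=> s z z' [Gz|[/= w1 n1 ->]] [Gz'|[/= w2 n2 ->]] //; first exact: Gfun Gz Gz'.
    by case: n2; case: (Gbase _ _ Gz).
  by case: n1; case: (Gbase _ _ Gz').
- move=> s s' z [Gz|[/= w1 n1 e1]] [Gz'|[/= w2 n2 e2]].
  + exact: Ginj Gz Gz'.
  + by case: (fN (j (map c s'))); rewrite -e2; case: (Gbase _ _ Gz).
  + by case: (fN (j (map c s))); rewrite -e1; case: (Gbase _ _ Gz').
  + by apply: c_inj => //; apply/j_inj/f_inj; rewrite -e1.
Qed.

(** For a maximal [G] the complement of the base has no room for a copy of the base,
    so it embeds in it, and then all of [X] embeds in two copies of the base. *)
Theorem seq_embeds : embeds nat [set: X] -> embeds (seq X) [set: X].
Proof.
move=> Xinf; have [G0 G0ok] := seq_inj_nat Xinf.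
have [F FP Ftot|G [GP Gmax]] := @Zorn_bigcup _ (fun G => G = set0 \/ @seq_inj G).
  case: (pselect (exists2 G, F G & G !=set0)) => [[G FG Gn0]|nex]; last first.
    left; apply/seteqP; split=> // p [G FG Gp]; case: nex; exists G => //; by exists p.
  right; have -> : \bigcup_(G in F) G = \bigcup_(G in F `&` [set G | G !=set0]) G.
    apply/seteqP; split=> p [H]; first by move=> FH Hp; exists H => //; split=> //; exists p.
    by move=> [FH _] Hp; exists H.
  apply: seq_inj_bigcup; last by exists G.
    by move=> H [/FP[->|//] [p]].
  by move=> H H' [FH _] [FH' _]; apply: Ftot.
have {GP} okG : seq_inj G.
  case: GP => // G_0; exfalso; apply: (Gmax G0); last by right.
  have [_ /(_ [::])[//|z Gz] _ _] := G0ok.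
  by rewrite G_0; split=> [p //|/(_ _ Gz)].
have GY := seq_inj_embeds okG.
have [[f [f_inj fN]]|[g g_inj]] := embeds_total (seq_inj_base G) (~` seq_inj_base G).
  have [G' GG' okG'] := seq_inj_extend okG f_inj fN.
  by case: (Gmax G' GG'); right.
have YX : embeds (seq_inj_base G) [set: X] by apply: embeds_inj val_inj.
apply: embeds_trans YX; apply: embeds_trans (seq_bool_embeds GY).
pose c x : bool * seq_inj_base G :=
  if pselect (seq_inj_base G x) is left h then (true, SigSub (mem_set h)) else (false, g x).
suff c_inj : injective c by apply: embeds_inj (inj_map c_inj).
move=> x y; rewrite /c; case: pselect => hx; case: pselect => hy // [].
  by [].
by apply: g_inj; rewrite inE.
Qed.
End SeqEmbeds.

(** * Blueprints *)

Section Blueprints.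
Variables (tau : vocabulary) (U : set nat) (A : structure tau U).

(** See the beginning of the file; [[:: 1; 0]] and [[:: 0; 1]] are the masks of the
    two maps from the ordinal 1 to the ordinal 2. *)
Definition blueprint (E : seq nat -> U -> U) (d : U) : Prop :=
  [/\ forall b (s : seq U), exists p q, automorphism A p q /\ {in s, p =1 E b},
      forall b c e, mask_comp b c = Some e -> forall u, E b (E c u) = E e u &
      E [:: 1; 0] d <> E [:: 0; 1] d].

Section Decode.
Let D := diagram_dec A.
Variable g : nat -> nat.
Hypothesis gP : respects (constraints D) setT g.

Lemma branch_constraints i1 i2 i3 i4 : constraints D (four_points [:: i1; i2; i3; i4] g).
Proof. exact: gP. Qed.

Ltac constraint i1 i2 i3 i4 := have := branch_constraints i1 i2 i3 i4;
  rewrite /constraints /four_points; cbv beta iota zeta delta [nth];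
  repeat (case/andP => ?); move=> ?; assumption.

Lemma branch_comp_nil i1 : c_comp_nil i1 (g i1).
Proof. constraint i1 0 0 0. Qed.
Lemma branch_comp_nil_cons i1 : c_comp_nil_cons i1 (g i1).
Proof. constraint i1 0 0 0. Qed.
Lemma branch_comp_skip i1 i2 : c_comp_skip i1 (g i1) i2 (g i2).
Proof. constraint i1 i2 0 0. Qed.
Lemma branch_comp_cons_nil i1 : c_comp_cons_nil i1 (g i1).
Proof. constraint i1 0 0 0. Qed.
Lemma branch_comp_keep i1 i2 : c_comp_keep i1 (g i1) i2 (g i2).
Proof. constraint i1 i2 0 0. Qed.
Lemma branch_functor i1 i2 i3 i4 : c_functor D i1 (g i1) i2 (g i2) i3 (g i3) i4 (g i4).
Proof. constraint i1 i2 i3 i4. Qed.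
Lemma branch_point i1 : c_point D i1 (g i1).
Proof. constraint i1 0 0 0. Qed.
Lemma branch_point_apart i1 i2 i3 : c_point_apart i1 (g i1) i2 (g i2) i3 (g i3).
Proof. constraint i1 i2 i3 0. Qed.
Lemma branch_agree i1 i2 : c_agree D i1 (g i1) i2 (g i2).
Proof. constraint i1 i2 0 0. Qed.
Lemma branch_elem i1 : c_elem D i1 (g i1).
Proof. constraint i1 0 0 0. Qed.
Lemma branch_cancel i1 i2 : c_cancel D i1 (g i1) i2 (g i2).
Proof. constraint i1 i2 0 0. Qed.
Lemma branch_cancel' i1 i2 : c_cancel' D i1 (g i1) i2 (g i2).
Proof. constraint i1 i2 0 0. Qed.
Lemma branch_list_nil i1 : c_list_nil i1 (g i1).
Proof. constraint i1 0 0 0. Qed.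
Lemma branch_list_cons i1 i2 i3 : c_list_cons D i1 (g i1) i2 (g i2) i3 (g i3).
Proof. constraint i1 i2 i3 0. Qed.
Lemma branch_rel i1 i2 : c_rel D i1 (g i1) i2.
Proof. constraint i1 i2 0 0. Qed.
Lemma branch_fun i1 i2 i3 : c_fun D i1 (g i1) i2 (g i2) i3.
Proof. constraint i1 i2 i3 0. Qed.

Lemma branch_comp b c : g (coord 0 (nseq_code b) (nseq_code c)) =
  if mask_comp b c is Some d then (nseq_code d).+1 else 0.
Proof.
have hdE x l : hd (nseq_code (x :: l)) = x by rewrite /hd /= fstn_pair.
have tlE x l : tl (nseq_code (x :: l)) = nseq_code l by rewrite /tl /= sndn_pair.
elim: b c => [|x b IHb] c.
  case: c => [|y c]; first by have /implyP/(_ (eqxx _))/eqP := branch_comp_nil (coord 0 0 0).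
  have /implyP h := branch_comp_nil_cons (coord 0 0 (nseq_code (y :: c))).
  by apply/eqP/h; rewrite itagE ifstE isndE.
case: x => [|x].
  have /implyP h := branch_comp_skip (coord 0 (nseq_code (0 :: b)) (nseq_code c))
    (coord 0 (nseq_code b) (nseq_code c)).
  rewrite (eqP (h _)) ?IHb; first by rewrite /=; case: mask_comp.
  by rewrite itagE ifstE isndE hdE tlE !eqxx.
case: c => [|y c].
  have /implyP h := branch_comp_cons_nil (coord 0 (nseq_code (x.+1 :: b)) 0).
  by apply/eqP/h; rewrite itagE ifstE isndE hdE.
have /implyP h := branch_comp_keep (coord 0 (nseq_code (x.+1 :: b)) (nseq_code (y :: c)))
  (coord 0 (nseq_code b) (nseq_code c)).
rewrite (eqP (h _)) ?IHb; first by rewrite isndE hdE /=; case: mask_comp.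
by rewrite itagE ifstE isndE hdE !tlE !eqxx.
Qed.

Lemma elem_val (u : U) : elem D (set_val u). Proof. by apply/elemP; exists u. Qed.

Lemma branch_aut t c (u : U) : (t == 1) || (t == 2) ->
  exists w : U, g (coord t c (set_val u)) = set_val w.
Proof.
move=> t12; have /implyP h := branch_elem (coord t c (set_val u)).
by apply/elemP/h; rewrite itagE isndE t12 elem_val.
Qed.

(** That the relations are reflected, and not only preserved, comes from the negated
    atomic sentences in the diagram. *)
Lemma branch_automorphism c : exists p q, automorphism A p q /\
  forall u, g (coord 1 c (set_val u)) = set_val (p u).
Proof.
have /choice[p pP] u := @branch_aut 1 c u isT.
have /choice[q qP] u := @branch_aut 2 c u isT.
exists p, q; split=> //.
have pK : cancel p q.
  move=> u; apply: val_inj; rewrite -[LHS]qP.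
  have /implyP h := branch_cancel (coord 1 c (set_val u)) (coord 2 c (set_val (p u))).
  by rewrite (eqP (h _)) ?isndE // itagE ifstE elem_val pP /=.
have qK : cancel q p.
  move=> u; apply: val_inj; rewrite -[LHS]pP.
  have /implyP h := branch_cancel' (coord 2 c (set_val u)) (coord 1 c (set_val (q u))).
  by rewrite (eqP (h _)) ?isndE // itagE ifstE elem_val qP /=.
pose code (s : seq U) := nseq_code [seq term_code (Var tau u) | u <- s].
have branch_list s : g (coord 3 c (code s)) = code (map p s).
  elim: s => [|u s IHs].
    have /implyP h := branch_list_nil (coord 3 c (code [::])).
    by apply/eqP/h; rewrite itagE isndE.
  have /implyP h := branch_list_cons (coord 3 c (code (u :: s)))
    (coord 1 c (set_val u)) (coord 3 c (code s)).
  rewrite (eqP (h _)) ?IHs ?pP // itagE ifstE isndE /hd /tl /= fstn_pair !sndn_pair fstn_pair.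
  by rewrite elem_val !eqxx.
have codeE n (v : 'I_n -> U) : nseq_code [seq term_code (Var tau (v i)) | i <- enum 'I_n] =
    code (map v (enum 'I_n)) by rewrite /code -map_comp.
split=> //; split; first exact: can_inj pK.
- move=> f v; pose l := code (map v (enum 'I_(farity f))).
  pose a (k : U -> U) : atom tau U :=
    AEq (App (fun i => Var tau (k (v i)))) (Var tau (k (fint A v))).
  have /implyP := branch_fun (coord 3 c l) (coord 1 c (set_val (fint A v))) (set_val f).
  rewrite itagE ifstE !isndE !eqxx branch_list pP /l -map_comp -!codeE /= => h.
  have /h/asboolP a_p : D (npair 1 (atom_code (a id))).
    by apply/asboolP/(diagram_true A (a id)).
  by apply/esym; apply: (diagram_true A (a p)).1.
- move=> r v.
  have r_t t : atomic_diagram A (npair t (atom_code (ARel (fun i => Var tau (v i))))) ->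
      atomic_diagram A (npair t (atom_code (ARel (r := r) (fun i => Var tau (p (v i)))))).
    move=> t_v; have /implyP h := branch_rel (coord 3 c (code (map v (enum 'I_(rarity r)))))
      (npair t (set_val r)).
    move: h; rewrite itagE isndE fstn_pair sndn_pair branch_list /= -map_comp -!codeE => h.
    by apply/asboolP/h/asboolP.
  split=> [/(diagram_true A (ARel (fun i => Var tau (v i)))) /r_t /diagram_true //|pv].
  apply: contrapT => /(diagram_false A (ARel (fun i => Var tau (v i)))) /r_t /diagram_false; exact.
Qed.

Theorem exists_blueprint : exists E d, blueprint E d.
Proof.
have /choice[p0 p0P] := branch_automorphism.
have /choice[E EP] : forall a : seq nat * U, exists w,
    g (coord 4 (nseq_code a.1) (set_val a.2)) = set_val w /\
    forall k, set_val a.2 < k -> p0 (npair (nseq_code a.1) k) a.2 = w.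
  (* Any bound above [u] gives the value of the embedding at [u]; the successor is
     the least one. *)
  move=> [b u] /=; exists (p0 (npair (nseq_code b) (set_val u).+1) u).
  have e k : set_val u < k -> set_val (p0 (npair (nseq_code b) k) u) =
      g (coord 4 (nseq_code b) (set_val u)).
    move=> lt_u; have [q [_ <-]] := p0P (npair (nseq_code b) k).
    have /implyP h := branch_agree (coord 1 (npair (nseq_code b) k) (set_val u))
      (coord 4 (nseq_code b) (set_val u)).
    by apply/eqP/h; rewrite itagE ifstE isndE sndn_pair fstn_pair lt_u elem_val !eqxx.
  split=> [|k lt_u]; first by rewrite e.
  by apply: val_inj; apply: etrans (e _ lt_u) (esym (e _ _)).
have gE b u : g (coord 4 (nseq_code b) (set_val u)) = set_val (E (b, u)).
  by have [] := EP (b, u).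
have [d gd] : exists d : U, g (coord 5 0 0) = set_val d.
  have /implyP h := branch_point (coord 5 0 0).
  by apply/elemP/h; rewrite itagE.
exists (fun b u => E (b, u)), d; split.
- move=> b s; pose k := (\max_(u <- s) set_val u).+1.
  have [q [aut _]] := p0P (npair (nseq_code b) k).
  exists (p0 (npair (nseq_code b) k)), q; split=> // u us.
  have [_ -> //] := EP (b, u).
  by rewrite ltnS; apply: (@leq_bigmax_seq _ s xpredT (fun u : U => set_val u)).
- move=> b c e ebc u; apply: val_inj; rewrite -[LHS]gE -[RHS]gE.
  have /implyP h := branch_functor (coord 0 (nseq_code b) (nseq_code c))
    (coord 4 (nseq_code c) (set_val u))
    (coord 4 (nseq_code b) (set_val (E (c, u)))) (coord 4 (nseq_code e) (set_val u)).
  apply/eqP/h; rewrite branch_comp ebc gE itagE ifstE !isndE elem_val !eqxx //.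
- move=> e.
  have /implyP h := branch_point_apart (coord 5 0 0) (coord 4 (nseq_code [:: 1; 0]) (set_val d))
    (coord 4 (nseq_code [:: 0; 1]) (set_val d)).
  by move: h; rewrite gd !gE e !eqxx => /(_ isT).
Qed.

End Decode.
End Blueprints.

(** * The model built from a blueprint *)

Lemma automorphism_id (tau : vocabulary) (U : set nat) (A : structure tau U) :
  automorphism A id id.
Proof. by split=> //; split. Qed.

Lemma automorphism_comp (tau : vocabulary) (U : set nat) (A : structure tau U) p q p' q' :
  automorphism A p q -> automorphism A p' q' -> automorphism A (p' \o p) (q \o q').
Proof.
move=> [pK qK ep] [pK' qK' ep']; split; last exact: embedding_comp ep ep'.
  by move=> u /=; rewrite pK' pK.
by move=> u /=; rewrite qK qK'.
Qed.

Section Stretch.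
Variables (tau : vocabulary) (U : set nat) (A : structure tau U).
Variables (E : seq nat -> U -> U) (d : U).
Hypothesis E_blueprint : blueprint A E d.
Variables (X : eqType) (lt : rel X).
Hypothesis lt_irr : irreflexive lt.
Hypothesis lt_trans : transitive lt.
Hypothesis lt_total : forall x y, [\/ lt x y, x = y | lt y x].

Lemma blueprint_embedding b : embedding A A (E b).
Proof.
have [E_aut _ _] := E_blueprint; split.
- move=> u w euw; have [p [q [[pK _ _] pE]]] := E_aut b [:: u; w].
  by rewrite -[u]pK -[w]pK !pE ?euw // !inE eqxx ?orbT.
- move=> f v; have [p [q [[_ _ [_ pf _]] pE]]] := E_aut b (fint A v :: codom v).
  rewrite -pE ?mem_head // pf; congr fint; apply/funext => i /=.
  by rewrite pE // in_cons codom_f orbT.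
- move=> r v; have [p [q [[_ _ [_ _ pr]] pE]]] := E_aut b (codom v).
  rewrite pr; suff -> : p \o v = E b \o v by [].
  by apply/funext => i /=; rewrite pE // codom_f.
Qed.

(** The transition map between the copies of [A] attached to [s] and [t], for [s]
    contained in [t]. *)
Definition face (s t : seq X) : U -> U := E [seq nat_of_bool (x \in s) | x <- t].

Lemma mask_comp_mem (s t r : seq X) : {subset s <= t} ->
  mask_comp [seq nat_of_bool (x \in t) | x <- r]
            [seq nat_of_bool (x \in s) | x <- r & x \in t] =
  Some [seq nat_of_bool (x \in s) | x <- r].
Proof.
move=> st; elim: r => //= x r IHr; case: (boolP (x \in t)) => xt /=.
  by rewrite IHr.
by rewrite IHr /= (negPf (contraNN (st x) xt)).
Qed.

Lemma sorted_sub_filter (t r : seq X) : sorted lt t -> sorted lt r ->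
  {subset t <= r} -> [seq x <- r | x \in t] = t.
Proof.
move=> srt srr tr; apply: (irr_sorted_eq lt_trans lt_irr) => //.
  exact: sorted_filter.
by move=> x; rewrite mem_filter andb_idr // => /tr.
Qed.

Lemma face_comp s t r u : sorted lt t -> sorted lt r -> {subset s <= t} ->
  {subset t <= r} -> face t r (face s t u) = face s r u.
Proof.
move=> srt srr st tr; have [_ E_comp _] := E_blueprint; apply: E_comp.
by rewrite -{2}(sorted_sub_filter srt srr tr) mask_comp_mem.
Qed.

Definition point : Type := ({s : seq X | sorted lt s} * U)%type.

(** Equality in the direct limit. *)
Definition same_point (p q : point) : Prop :=
  exists r, [/\ sorted lt r, {subset val p.1 <= r}, {subset val q.1 <= r} &
    face (val p.1) r p.2 = face (val q.1) r q.2].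

Lemma common_sorted (ss : seq (seq X)) :
  exists r, sorted lt r /\ forall s, s \in ss -> {subset s <= r}.
Proof.
have [r srr er] := exists_sorted_subseq lt_trans lt_total (flatten ss).
by exists r; split=> // s sss x xs; rewrite er; apply/flattenP; exists s.
Qed.

Lemma same_point_at p q r : same_point p q -> sorted lt r ->
  {subset val p.1 <= r} -> {subset val q.1 <= r} ->
  face (val p.1) r p.2 = face (val q.1) r q.2.
Proof.
move=> [r' [srr' pr' qr' e]] srr pr qr.
have [r2 [sr2 h]] := common_sorted [:: r; r'].
have rr2 : {subset r <= r2} by apply: h; rewrite !inE eqxx.
have rr2' : {subset r' <= r2} by apply: h; rewrite !inE eqxx orbT.
have [inj _ _] := blueprint_embedding [seq nat_of_bool (x \in r) | x <- r2].
apply: inj; rewrite -!/(face _ _ _) !face_comp //.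
by rewrite -(face_comp _ srr' sr2 pr' rr2') e face_comp.
Qed.

Lemma same_point_sym p q : same_point p q -> same_point q p.
Proof. by move=> [r [? ? ? e]]; exists r; split=> //; rewrite e. Qed.

Lemma same_point_trans p q r : same_point p q -> same_point q r -> same_point p r.
Proof.
move=> pq qr; have [t [st h]] := common_sorted [:: val p.1; val q.1; val r.1].
have pt : {subset val p.1 <= t} by apply: h; rewrite !inE eqxx.
have qt : {subset val q.1 <= t} by apply: h; rewrite !inE eqxx orbT.
have rt : {subset val r.1 <= t} by apply: h; rewrite !inE eqxx !orbT.
exists t; split=> //; rewrite (same_point_at pq) //; exact: same_point_at.
Qed.

Lemma same_point_refl p : same_point p p.
Proof. by exists (val p.1); split=> //; apply: valP. Qed.

Definition stretch : Type := set_type (range same_point).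

Definition elt (p : point) : stretch := SigSub (mem_set (imageT same_point p)).

Lemma eltP p q : elt p = elt q <-> same_point p q.
Proof.
split=> [/(congr1 val) /= ->|pq]; first exact: same_point_refl.
apply: val_inj; apply/funext => r /=; apply/propext; split.
  exact/same_point_trans/same_point_sym.
exact: same_point_trans.
Qed.

Lemma elt_surj y : exists p, elt p = y.
Proof.
have [p _ ep] := set_mem (valP y); exists p; exact: val_inj.
Qed.

(** The canonical map from the copy of [A] attached to [s]. *)
Definition over (s : {s : seq X | sorted lt s}) (u : U) : stretch := elt (s, u).

Lemma over_face s t u : {subset val s <= val t} -> over s u = over t (face (val s) (val t) u).
Proof.
move=> st; apply/eltP; exists (val t) => /=; split=> //; first exact: valP.
by rewrite face_comp //; apply: valP.
Qed.

Lemma over_inj s : injective (over s).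
Proof.
move=> u w /eltP e.
have /= := same_point_at e (valP s) (fun _ h => h) (fun _ h => h).
by have [inj _ _] := blueprint_embedding [seq nat_of_bool (x \in val s) | x <- val s]; apply: inj.
Qed.

Lemma common_support n (v : 'I_n -> stretch) (ss : seq {s : seq X | sorted lt s}) :
  exists s w, v = over s \o w /\ forall t, t \in ss -> {subset val t <= val s}.
Proof.
have /choice[p pv] : forall i, exists p, elt p = v i by move=> i; apply: elt_surj.
have [r [srr h]] := common_sorted ([seq val (p i).1 | i <- enum 'I_n] ++ map val ss).
pose s : {s : seq X | sorted lt s} := exist _ r srr.
exists s, (fun i => face (val (p i).1) r (p i).2); split; last first.
  by move=> t ts; apply: h; rewrite mem_cat map_f ?orbT.
apply/funext => i /=; rewrite -[RHS](@over_face (p i).1 s) /=.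
  by rewrite -pv; case: (p i).
by apply: h; rewrite mem_cat; apply/orP; left; apply/mapP; exists i; rewrite ?mem_enum.
Qed.

(** Families that agree in the limit already agree at some finite stage. *)
Lemma over_common n s s' (w w' : 'I_n -> U) : over s \o w = over s' \o w' ->
  exists t : {s : seq X | sorted lt s}, [/\ {subset val s <= val t}, {subset val s' <= val t} &
    face (val s) (val t) \o w = face (val s') (val t) \o w'].
Proof.
move=> e; have [r [srr h]] := common_sorted [:: val s; val s'].
have sr : {subset val s <= r} by apply: h; rewrite !inE eqxx.
have sr' : {subset val s' <= r} by apply: h; rewrite !inE eqxx orbT.
exists (exist _ r srr); split=> //; apply/funext => i /=.
by have /eltP/same_point_at := congr1 (fun f => f i) e; apply.
Qed.

Definition stretch_fint (f : Defs.fsym tau) (v : 'I_(farity f) -> stretch) : stretch :=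
  let s := cid (common_support v [::]) in
  over (projT1 s) (fint A (projT1 (cid (projT2 s)))).

Definition stretch_rint (r : rsym tau) (v : 'I_(rarity r) -> stretch) : Prop :=
  exists s w, v = over s \o w /\ rint A w.

Definition stretch_structure : structure tau stretch :=
  Structure (inhabits (elt (exist _ [::] isT, d))) stretch_fint stretch_rint.

Lemma over_embedding s : embedding A stretch_structure (over s).
Proof.
split; first exact: over_inj.
- move=> f w /=; rewrite /stretch_fint; case: cid => s' hs' /=; case: cid => w' /= [e _].
  have [t [st st' et]] := over_common e.
  rewrite (over_face _ st) (over_face _ st').
  have [_ Ef _] := blueprint_embedding [seq nat_of_bool (x \in val s) | x <- val t].
  have [_ Ef' _] := blueprint_embedding [seq nat_of_bool (x \in val s') | x <- val t].
  by rewrite /face Ef Ef' -/(face _ _) et.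
- move=> r w /=; split=> [Aw|[s' [w' [e Aw']]]]; first by exists s, w.
  have [t [st st' et]] := over_common e.
  have [_ _ Er] := blueprint_embedding [seq nat_of_bool (x \in val s) | x <- val t].
  have [_ _ Er'] := blueprint_embedding [seq nat_of_bool (x \in val s') | x <- val t].
  by apply: (Er _ _).2; rewrite -/(face _ _) et; apply: (Er' _ _).1.
Qed.

(** The system consists of the tuples of the limit that come, at some finite stage,
    from an automorphic image of the given tuple of [A].  Going to a later stage
    applies a transition map, which on the tuple at hand can be replaced by an
    automorphism. *)
Lemma stretch_back_and_forth : back_and_forth A stretch_structure
  (fun n e e' => exists s p q, automorphism A p q /\ e' = over s \o (p \o e)).
Proof.
move=> n e _ [s [p [q [aut_p ->]]]]; have [pK qK emb_p] := aut_p; split.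
- by move=> a; have := atom_embedding e a (embedding_comp emb_p (over_embedding s)); tauto.
- by move=> x; exists (over s (p x)), s, p, q; rewrite !comp_env_cons.
- (* [p'] replaces, on the tuple at hand, the transition map to a stage [t] where
     [y] lives. *)
  move=> y; have [t [w [ey h]]] := common_support (fun _ : 'I_1 => y) [:: s].
  have {}ey : y = over t (w ord0) by have := congr1 (fun f => f ord0) ey.
  have [E_aut _ _] := E_blueprint.
  have [p' [q' [aut_p' pE]]] := E_aut [seq nat_of_bool (x \in val s) | x <- val t] (codom (p \o e)).
  have [pK' qK' _] := aut_p'.
  exists (q (q' (w ord0))), t, (p' \o p), (q \o q'); split; first exact: automorphism_comp.
  rewrite !comp_env_cons /= qK qK' -ey; congr env_cons; apply/funext => i /=.
  rewrite pE; last by rewrite -[p (e i)]/((p \o e) i) codom_f.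
  by apply: over_face; apply: h; rewrite mem_head.
Qed.

Lemma stretch_models (phi : sentence tau) :
  models A phi -> models stretch_structure phi.
Proof.
move=> A_phi e; have [u0] := universe_nonempty A.
apply/(@back_and_forth_sat _ _ _ _ _ _ stretch_back_and_forth 0 phi (fun=> u0) e); last exact: A_phi.
exists (exist _ [::] isT), id, id; split; first exact: automorphism_id.
by apply/funext => -[].
Qed.

(** A point of the limit is determined by a finite list over [X] and an element of
    [A], which together are coded by a longer list.  Conversely the images of [d]
    over different singletons are separated over the pair. *)
Lemma stretch_card : embeds nat [set: X] -> [set: stretch] #= [set: X].
Proof.
move=> Xinf; apply/card_eqPle; split; apply/card_le_embeds.
  have /choice[p pP] := elt_surj.
  have [u [u_inj _]] := Xinf; have [j [j_inj _]] := seq_embeds Xinf.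
  apply: (embeds_inj (f := fun y => j (u (set_val (p y).2) :: val (p y).1))).
  move=> y z /j_inj [/u_inj/val_inj e2 /val_inj e1].
  by rewrite -(pP y) -(pP z) [p y]surjective_pairing e1 e2 -surjective_pairing.
pose single x : {s : seq X | sorted lt s} := exist _ [:: x] isT.
have ne x y : lt x y -> over (single x) d <> over (single y) d.
  move=> xy /eltP e; have h := same_point_at (r := [:: x; y]) e; have [_ _] := E_blueprint; apply.
  have nxy : x == y = false by apply/eqP => exy; rewrite exy lt_irr in xy.
  have := h _ _ _; rewrite /face /= !inE !eqxx nxy [y == x]eq_sym nxy; apply.
  - by rewrite xy.
  - by move=> z; rewrite !inE => ->.
  - by move=> z; rewrite !inE => ->; rewrite orbT.
apply: (embeds_inj (f := fun x => over (single x) d)) => x y e.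
by case: (lt_total x y) => // /ne; rewrite e.
Qed.

End Stretch.

(** * Models of all infinite cardinalities *)

Theorem theorem1p1 (tau : vocabulary) (htau : computable_vocabulary tau)
    (U : set nat) (A : structure tau U) (hA : computable_structure A)
    (phi : sentence tau) (hphi : scott_sentence A phi)
    (hbeth : forall alpha : well_order, lt_omega1CK alpha ->
       exists (M : Type) (B : structure tau M),
         models B phi /\ has_card_beth M alpha) :
  forall X : Type, infinite_set [set: X] ->
    exists (M : Type) (B : structure tau M),
      models B phi /\ [set: M] #= [set: X].
Proof.
(* Lists over [X0] are used with decidable membership, which {classic X0} provides
   without changing the type. *)
move=> X0 /infiniteP/card_le_embeds; pose X : eqType := {classic X0}.
change (embeds nat [set: X] -> exists (M : Type) (B : structure tau M),
  models B phi /\ [set: M] #= [set: X]) => Xinf.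
have irr (M : eqType) (lt : rel M) : well_founded lt -> irreflexive lt.
  by move=> wf x; apply/negP; apply: lt_irr.
have [g gP] : exists g, respects (constraints (diagram_dec A)) setT g.
  apply: (exists_branch (recb_constraints (diagram_dec_computable hA)) (arity := arity)).
  move=> a /hbeth[M0 [B [B_phi cardM]]]; pose M : eqType := {classic M0}.
  have [lt [wf tr tot]] := exists_well_order M.
  have [value rlz] := @model_realizes _ _ A phi M B lt hphi B_phi (irr _ _ wf) tr tot.
  by exists M, lt, value.
have [E [d bp]] := exists_blueprint gP.
have [lt [/irr lt_irr tr tot]] := exists_well_order X.
have A_phi : models A phi.
  apply/hphi; first by apply: countableP.
  exists id; split=> //; by exists id.
exists (stretch E lt), (stretch_structure bp lt_irr tr tot).
by split; [apply: stretch_models A_phi|apply: (stretch_card bp lt_irr tr tot Xinf)].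
Qed.
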